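(* Let $\mathcal D=(V,E)$ be a directed acyclic graph on $V=\{1,\dots,p\}$ in a parent ordering and $U$ a symmetric positive definite $p\times p$ matrix. Suppose $\Sigma=L^{-\top}DL^{-1}$ with $(D,L)\sim\pi^{\Theta_{\mathcal D}}_{U,\alpha}$, and assume $\alpha_i>pa_i+4$ for every $i$. Define $$m_i=U_{\prec i\succ}^{-1}U_{\prec i]},\qquad r_i=\frac{U_{ii\mid\prec i\succ}}{\alpha_i-pa_i-4},\qquad B_i=r_iU_{\prec i\succ}^{-1}+m_im_i^\top,$$ where for an empty parent set $m_i$ and $B_i$ are empty and $r_i=U_{ii}/(\alpha_i-4)$. Then the symmetric matrix $M=\mathbb E(\Sigma)$ is obtained recursively for $i=p,p-1,\dots,1$ by $$M_{ji}=M_{ij}=M_{j,\prec i\succ}m_i,\qquad j=i+1,\dots,p,$$ $$M_{ii}=r_i+\operatorname{tr}\big(M_{\prec i\succ}B_i\big),$$ where, when $\mathrm{pa}(i)=\emptyset$, the first expression is zero and the trace term is absent. In particular, $\mathbb E(\Sigma^E)=M^E$.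
   Context: Parent ordering: every directed edge $i\to j$ satisfies $i>j$. $E$ contains all loops $(i,i)$, and for $i\neq j$, $(i,j)\in E$ means $i\to j$. $\mathrm{pa}(i)$ is the set of parents of $i$ (excluding $i$), $pa_i=|\mathrm{pa}(i)|$. For a $p\times p$ matrix $A$: $A_{\prec i\succ}$ is the principal submatrix indexed by $\mathrm{pa}(i)$; $A_{j,\prec i\succ}=(A_{jk})_{k\in\mathrm{pa}(i)}$ (row); $A_{\prec i]}=(A_{ji})_{j\in\mathrm{pa}(i)}$ (column), $A_{[i\succ}=(A_{ij})_{j\in\mathrm{pa}(i)}$ (row); $A_{\prec i\succ}^{-1}=(A_{\prec i\succ})^{-1}$; $A_{ii\mid\prec i\succ}=A_{ii}-A_{[i\succ}A_{\prec i\succ}^{-1}A_{\prec i]}$. $A^E$ denotes the incomplete symmetric matrix keeping only the diagonal entries of $A$ and the entries on edges of the undirected version of $\mathcal D$. $\mathcal L_{\mathcal D}$: real lower triangular $p\times p$ matrices with unit diagonal and $L_{ij}=0$ for $i\neq j$, $i\notin\mathrm{pa}(j)$. $\Theta_{\mathcal D}$: pairs $(D,L)$ with $D$ diagonal with strictly positive diagonal and $L\in\mathcal L_{\mathcal D}$. The DAG--Wishart distribution $\pi^{\Theta_{\mathcal D}}_{U,\alpha}$ is the probability law on $\Theta_{\mathcal D}$ with density proportional to $\exp\{-\frac12\operatorname{tr}(LD^{-1}L^\top U)\}\prod_iD_{ii}^{-\alpha_i/2}$ with respect to $\prod_idD_{ii}\prod_i\prod_{j\in\mathrm{pa}(i)}dL_{ji}$.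 *)

(* Defs.v *)
From HB Require Import structures.
From mathcomp Require Import all_boot all_order all_algebra.
From mathcomp Require Import all_classical all_reals all_analysis.

Set Implicit Arguments.
Unset Strict Implicit.
Unset Printing Implicit Defensive.

Import Order.TTheory GRing.Theory Num.Theory.

Local Open Scope classical_set_scope.
Local Open Scope ring_scope.

Section lebesgue_tuple.
Context {R : realType}.

(* [lebesgue_measure] lives on [measurableTypeR R], whose sigma-algebra is that
   of [R] under another display; hence the ascription on the first factor. *)
Definition cons_pair n (x : measurableTypeR R * n.-tuple R) : n.+1.-tuple R :=
  [tuple of x.1 :: x.2].

Lemma measurable_cons_pair n : measurable_fun setT (@cons_pair n).
Proof.
exact: (@measurable_cons _ _ _ R).
Qed.

Section cons.
Context n (m : {sigma_finite_measure set (n.-tuple R) -> \bar R}).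

Definition lebesgue_cons : set (n.+1.-tuple R) -> \bar R :=
  pushforward (lebesgue_measure \x m)%E (@cons_pair n).

Let pushforward_cons : {measure set (n.+1.-tuple R) -> \bar R} :=
  measure_function_pushforward__canonical__measure_function_Measure
    (lebesgue_measure \x m)%E (@measurable_cons_pair n).

Let lebesgue_cons0 : lebesgue_cons set0 = 0%E.
Proof. exact: (measure0 pushforward_cons). Qed.

Let lebesgue_cons_ge0 A : (0 <= lebesgue_cons A)%E.
Proof. exact: (measure_ge0 pushforward_cons). Qed.

Let lebesgue_cons_semi_sigma_additive : semi_sigma_additive lebesgue_cons.
Proof. exact: (@measure_semi_sigma_additive _ _ _ pushforward_cons). Qed.

HB.instance Definition _ := isMeasure.Build _ _ _ lebesgue_cons
  lebesgue_cons0 lebesgue_cons_ge0 lebesgue_cons_semi_sigma_additive.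

Let lebesgue_cons_sigma_finite : sigma_finite setT lebesgue_cons.
Proof.
have /sigma_finiteP[F [TF ndF Foo]] :=
  @sigma_finiteT _ _ _ (@lebesgue_measure R).
have /sigma_finiteP[G [TG ndG Goo]] := @sigma_finiteT _ _ _ m.
pose uncons (t : n.+1.-tuple R) : measurableTypeR R * n.-tuple R :=
  (thead t, [tuple of behead t]).
have unconsK x : uncons (cons_pair x) = x.
  by case: x => x t; congr pair; apply/val_inj.
have muncons : measurable_fun setT uncons.
  apply/measurable_fun_pairP; split => /=; last exact: measurable_behead.
  exact: (@measurable_tnth _ R).
exists (fun k => uncons @^-1` (F k `*` G k)) => [|k].
  rewrite -preimage_bigcup (_ : \bigcup_k _ = setT) ?preimage_setT//.
  apply/seteqP; split => // -[x t] _.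
  have [i _ Fix] : (\bigcup_k F k) x by rewrite -TF.
  have [j _ Gjt] : (\bigcup_k G k) t by rewrite -TG.
  exists (maxn i j) => //; split => /=.
    by move: Fix; exact/subsetPset/ndF/leq_maxl.
  by move: Gjt; exact/subsetPset/ndG/leq_maxr.
have [mF Fkoo] := Foo k; have [mG Gkoo] := Goo k; split.
  by rewrite -[X in measurable X]setTI; apply: muncons => //; exact: measurableX.
rewrite /lebesgue_cons /pushforward (_ : _ @^-1` _ = F k `*` G k).
  by rewrite product_measure1E// lte_mul_pinfty// ge0_fin_numE.
by apply/funext => x; rewrite /preimage /mkset unconsK.
Qed.

HB.instance Definition _ := Measure_isSigmaFinite.Build _ _ _ lebesgue_cons
  lebesgue_cons_sigma_finite.

End cons.

Fixpoint lebesgue_tuple n : {sigma_finite_measure set (n.-tuple R) -> \bar R} :=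
  match n with
  | 0 => \d_([tuple] : 0.-tuple R)
  | n'.+1 => lebesgue_cons (lebesgue_tuple n')
  end.

End lebesgue_tuple.

Section parent_ordered_dag.
Context {p : nat} (E : {set 'I_p * 'I_p}).

(* [(i, j) \in E] reads [i -> j]; [E] contains all the loops, which are ignored
   when speaking of directed cycles. *)
Definition dag :=
  (forall i, (i, i) \in E) /\
  antisymmetric (connect (fun i j => (i, j) \in E)).

Definition parent_ordering := forall i j : 'I_p, i != j -> (i, j) \in E -> (j < i)%N.

Definition pa (i : 'I_p) : {set 'I_p} := [set j | (j != i) && ((j, i) \in E)].

Definition skeleton : {set 'I_p * 'I_p} :=
  [set e | (e \in E) || ((e.2, e.1) \in E)].

End parent_ordered_dag.

Section submatrices.
Context {R : realType} {p : nat} (E : {set 'I_p * 'I_p}).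
Implicit Types (A : 'M[R]_p) (i j : 'I_p).

(* $A_{\prec i\succ}$ *)
Definition mx_pa A i : 'M[R]_#|pa E i| := mxsub enum_val enum_val A.

(* $A_{j,\prec i\succ}$; in particular $A_{[i\succ}$ is [row_pa A i i] *)
Definition row_pa A j i : 'rV[R]_#|pa E i| := \row_k A j (enum_val k).

(* $A_{\prec i]}$ *)
Definition col_pa A i : 'cV[R]_#|pa E i| := \col_k A (enum_val k) i.

(* $A_{ii\mid\prec i\succ}$ *)
Definition schur_pa A i : R :=
  A i i - (row_pa A i i *m invmx (mx_pa A i) *m col_pa A i) 0 0.

(* The incomplete matrix $A^E$: only the entries on the diagonal and on the
   undirected edges are specified. *)
Definition incomplete A : {ffun {e | e \in skeleton E} -> R} :=
  [ffun e => A (val e).1 (val e).2].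

End submatrices.

Definition posdefmx {R : realType} p (U : 'M[R]_p) :=
  U^T = U /\ forall x : 'cV[R]_p, x != 0 -> 0 < (x^T *m U *m x) 0 0.

Section dag_wishart.
Context {R : realType} {p : nat} (E : {set 'I_p * 'I_p}).
Implicit Types (D L : 'M[R]_p).

Definition cholesky_space L :=
  [/\ is_trig_mx L, forall i, L i i = 1 &
     forall i j, i != j -> i \notin pa E j -> L i j = 0].

Definition Theta D L :=
  [/\ is_diag_mx D, forall i, 0 < D i i & cholesky_space L].

(* The free parameters of [(D, L)] are indexed by [E]: the loop [(i, i)] carries
   $D_{ii}$ and the edge $j \to i$ carries $L_{ji}$. *)
Definition Theta_coord D L : #|E|.-tuple R :=
  [tuple of [seq if e.1 == e.2 then D e.1 e.1 else L e.1 e.2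
            | e <- enum_tuple [in E]]].

(* [D_of_coord] and [L_of_coord] invert [Theta_coord]; outside [E] the index is
   out of range and [nth] returns 0. *)
Definition edge_coord (t : #|E|.-tuple R) (e : 'I_p * 'I_p) : R :=
  nth 0 t (index e (enum E)).

Definition D_of_coord (t : #|E|.-tuple R) : 'M[R]_p :=
  diag_mx (\row_i edge_coord t (i, i)).

Definition L_of_coord (t : #|E|.-tuple R) : 'M[R]_p :=
  \matrix_(i, j) if i == j then 1 else edge_coord t (i, j).

Context (U : 'M[R]_p) (alpha : 'I_p -> R).

Definition dag_wishart_kernel D L : R :=
  expR (- (2^-1 * \tr (L *m invmx D *m L^T *m U))) *
  \prod_i (D i i) `^ (- (alpha i / 2)).

(* Unnormalised law of the free parameters. *)
Definition dag_wishart_mass (A : set (#|E|.-tuple R)) : \bar R :=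
  (\int[lebesgue_tuple #|E|]_(t in
       A `&` [set t | Theta (D_of_coord t) (L_of_coord t)])
     (dag_wishart_kernel (D_of_coord t) (L_of_coord t))%:E)%E.

Definition dag_wishart d (T : measurableType d) (P : probability T R)
    (D L : T -> 'M[R]_p) :=
  let theta w := Theta_coord (D w) (L w) in
  [/\ forall w, Theta (D w) (L w),
     measurable_fun setT theta &
     exists c : R, forall A, measurable A ->
       P (theta @^-1` A) = (c%:E * dag_wishart_mass A)%E].

End dag_wishart.

Section expectations.
Context {R : realType} d {T : measurableType d} (P : probability T R).

Definition mean_mx {m n} (X : T -> 'M[R]_(m, n)) : 'M[R]_(m, n) :=
  \matrix_(i, j) fine 'E_P[fun w => X w i j].

Definition mean_ffun {I : finType} (X : T -> {ffun I -> R}) : {ffun I -> R} :=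
  [ffun i => fine 'E_P[fun w => X w i]].

End expectations.

Section mean_recursion.
Context {R : realType} {p : nat} (E : {set 'I_p * 'I_p}).
Context (U : 'M[R]_p) (alpha : 'I_p -> R).

Definition m_ (i : 'I_p) : 'cV[R]_#|pa E i| := invmx (mx_pa E U i) *m col_pa E U i.

Definition r_ (i : 'I_p) : R := schur_pa E U i / (alpha i - #|pa E i|%:R - 4).

Definition B_ (i : 'I_p) : 'M[R]_#|pa E i| :=
  r_ i *: invmx (mx_pa E U i) + m_ i *m (m_ i)^T.

(* For an empty parent set the matrices below have a zero dimension, so that the
   product and the trace vanish and [r_ i] is [U i i / (alpha i - 4)]. *)
Definition mean_recursion (M : 'M[R]_p) :=
  forall i : 'I_p,
    (forall j : 'I_p, (i < j)%N ->
       M j i = M i j /\ M i j = (row_pa E M j i *m m_ i) 0 0) /\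
    M i i = r_ i + \tr (mx_pa E M i *m B_ i).

End mean_recursion.

(* Main.v *)
Require Import Defs.
From mathcomp Require Import all_boot all_order all_algebra.
From mathcomp Require Import all_classical all_reals all_analysis.
From mathcomp Require Import measurable_realfun.
From mathcomp Require Import ring lra zify.

Set Implicit Arguments.
Unset Strict Implicit.
Unset Printing Implicit Defensive.

Import Order.TTheory GRing.Theory Num.Theory.
Import numFieldNormedType.Exports.

Local Open Scope classical_set_scope.
Local Open Scope ring_scope.

(** Write x_i = D_ii, l_i for the column of the L_ji with j in pa(i), and
    Q_i, s_i, m_i for U_<i>, U_ii|<i> and Q_i^-1 U_<i].

    Why the recursion holds. Completing the square column by column gives
      tr(L D^-1 L^T U) = sum_i (s_i + (l_i + m_i)^T Q_i (l_i + m_i)) / x_i,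
    so that the density is a product of one factor for each pair (x_i, l_i)
    ([dag_wishart_kernel_prod]): the columns are independent, and a column has
      E x_i = r_i,   E l_i = - m_i,   E (l_i l_i^T) = B_i.
    On the other hand L^T Sigma L = D yields ([cholesky_recursion])
      Sigma_ji = - sum_(k in pa(i)) Sigma_jk l_ki                       (j > i),
      Sigma_ii = x_i + sum_(k, l in pa(i)) Sigma_kl l_ki l_li,
    where the entries of Sigma on the right only depend on the columns after i
    and hence are independent of (x_i, l_i). Taking expectations is the stated
    recursion. Integrability, measurability and uniqueness are proved along the
    same descent from later to earlier vertices ([parent_ind]).

    How the moments of a column are computed. They come from invariances of
    Lebesgue measure rather than from explicit Gaussian and gamma integrals:
    coordinatewise affine maps preserve it up to a Jacobian
    ([ge0_integral_affine_tuple]). For a one-parameter family of such maps, if F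
    and its derivative G along the family are integrable, then the integral of G
    vanishes ([integral_flow0]); this is an integration by parts whose boundary
    terms disappear by integrability alone. With y = l_i + m_i and H a function
    of the other columns, such that H times the density is integrable,
    - the scaling x -> exp(2u) x, y -> exp(u) y, applied to F = H x, gives
        (alpha_i - |pa(i)| - 4) E(H x) = s_i E(H)      ([integral_col_diag]);
    - the translations of the coordinate y_k, applied to F = H x and to
      F = H x y_j, give
        E(H (Q y)_k) = 0   and   E(H y_j (Q y)_k) = [j = k] E(H x)
                                 ([integral_col] and [integral_colMQ]).
    The functions F and G have to be integrable beforehand. That the whole mass
    is finite comes with the law being a probability; replacing x by
    x / (1 + eps x) makes everything integrable, and the scaling identity then
    bounds the truncated moments uniformly in eps ([integrable_col_diag]). *)

(** * Coordinatewise affine changes of variables *)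

Section affine_invariance.
Context {R : realType}.
Local Open Scope ereal_scope.

Lemma measurable_affine (a b : R) :
  measurable_fun setT (fun x : measurableTypeR R => (a * x + b)%R : measurableTypeR R).
Proof.
apply: measurable_funD; last exact: measurable_cst.
exact: mulrl_measurable.
Qed.

(** The image of Lebesgue measure under x |-> a x + b, multiplied by a, gives
    the interval ]c, d] the mass d - c, and intervals determine the measure. *)
Lemma ge0_integral_lebesgue_affine (a b : R) (f : measurableTypeR R -> \bar R) :
  (0 < a)%R -> measurable_fun setT f -> (forall x, 0 <= f x) ->
  \int[lebesgue_measure]_x (a%:E * f (a * x + b)%R) =
  \int[lebesgue_measure]_x f x.
Proof.
move=> a0 mf f0.
have man : (0 <= a)%R by exact: ltW.
pose mu' : {measure set (measurableTypeR R) -> \bar R} :=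
  mscale (NngNum man) (measure_function_pushforward__canonical__measure_function_Measure
    (@lebesgue_measure R) (@measurable_affine a b)).
have mu'E A : mu' A = a%:E * lebesgue_measure ((fun x => a * x + b)%R @^-1` A) by [].
have E A : measurable A -> lebesgue_measure A = mu' A.
  apply: lebesgue_measure_unique => _ [[c d'] _ <-] /=.
  rewrite mu'E.
  have -> : (fun x => a * x + b)%R @^-1` `]c, d']%classic = `]((c - b) / a)%R, ((d' - b) / a)%R]%classic.
    apply/seteqP; split => x /=; rewrite !in_itv/= ltr_pdivrMr// ler_pdivlMr//;
      by rewrite ltrBlDr lerBrDr (mulrC x).
  rewrite !lebesgue_measure_itv/= !lte_fin ltr_pM2r ?invr_gt0// ltrD2r.
  case: ifP => _; last by rewrite mule0.
  rewrite -EFinD -EFinM; congr EFin.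
  by rewrite -mulrBl mulrCA mulfV ?gt_eqF// mulr1 opprB addrA subrK.
rewrite [RHS](eq_measure_integral mu'); last by move=> A mA _; exact: E.
rewrite ge0_integral_mscale//= ge0_integral_pushforward//; last exact: measurable_affine.
rewrite ge0_integralZl//.
by apply: measurableT_comp => //; exact: measurable_affine.
Qed.

Definition affine_tuple n (u v : 'I_n -> R) (t : n.-tuple R) : n.-tuple R :=
  [tuple (u i * tnth t i + v i)%R | i < n].

Lemma measurable_affine_tuple n (u v : 'I_n -> R) :
  measurable_fun setT (affine_tuple u v).
Proof.
apply/measurable_fun_tnthP => i.
rewrite (_ : _ \o _ = fun t => (u i * tnth t i + v i)%R); last first.
  by apply/funext => t; rewrite /= tnth_mktuple.
apply: measurable_funD; last exact: measurable_cst.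
by apply: measurable_funM; [exact: measurable_cst|exact: measurable_tnth].
Qed.

Lemma affine_tuple_cons n (u v : 'I_n.+1 -> R) x (t : n.-tuple R) :
  affine_tuple u v (cons_pair (x, t)) =
  cons_pair ((u ord0 * x + v ord0)%R,
    affine_tuple (fun i => u (lift ord0 i)) (fun i => v (lift ord0 i)) t).
Proof.
apply: eq_from_tnth => i; rewrite tnth_mktuple.
case: (unliftP ord0 i) => [j|] ->; last by rewrite !tnth0.
by rewrite !tnthS tnth_mktuple.
Qed.

Lemma ge0_integral_lebesgue_cons n (f : n.+1.-tuple R -> \bar R) :
  measurable_fun setT f -> (forall t, 0 <= f t) ->
  \int[lebesgue_tuple n.+1]_t f t =
  \int[lebesgue_measure]_x \int[lebesgue_tuple n]_t f (cons_pair (x, t)).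
Proof.
move=> mf f0.
rewrite [LHS](ge0_integral_pushforward (@measurable_cons_pair R n))//.
rewrite preimage_setT fubini_tonelli1//.
  exact: (measurableT_comp mf (@measurable_cons_pair R n)).
by move=> x; exact: f0.
Qed.

(** Tonelli and the one-dimensional case, one coordinate at a time; the
    map being diagonal, its Jacobian is the product of the slopes. *)
Lemma ge0_integral_affine_tuple n (u v : 'I_n -> R) (f : n.-tuple R -> \bar R) :
  (forall i, (0 < u i)%R) -> measurable_fun setT f -> (forall t, 0 <= f t) ->
  \int[lebesgue_tuple n]_t ((\prod_i u i)%:E * f (affine_tuple u v t)) =
  \int[lebesgue_tuple n]_t f t.
Proof.
elim: n u v f => [|n IH] u v f u0 mf f0.
  apply: eq_integral => t _; rewrite big_ord0 mul1e.
  by rewrite (tuple0 (affine_tuple _ _ _)) (tuple0 t).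
have pu0 m (w : 'I_m -> R) : (forall i, 0 < w i)%R -> (0 <= \prod_i w i)%R.
  by move=> w0; apply: prodr_ge0 => i _; exact: ltW.
rewrite !ge0_integral_lebesgue_cons//; last 2 first.
- apply: emeasurable_funM => //.
  by apply: measurableT_comp => //; exact: measurable_affine_tuple.
- by move=> t; rewrite mule_ge0// lee_fin pu0.
have mc x : measurable_fun setT (fun t : n.-tuple R => f (cons_pair (x, t))).
  apply: measurableT_comp => //.
  by apply: (measurableT_comp (@measurable_cons_pair R n)) => //; exact: measurable_pair1.
rewrite -(@ge0_integral_lebesgue_affine (u ord0) (v ord0)
  (fun x => \int[lebesgue_tuple n]_t f (cons_pair (x, t))))//; last 2 first.
- apply: (measurable_fun_fubini_tonelli_F (f \o @cons_pair R n)) => [|x].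
    exact: (measurableT_comp mf (@measurable_cons_pair R n)).
  exact: f0.
- by move=> x; apply: integral_ge0 => t _; exact: f0.
apply: eq_integral => x _.
rewrite -(IH (fun i => u (lift ord0 i)) (fun i => v (lift ord0 i))
  (fun t => f (cons_pair ((u ord0 * x + v ord0)%R, t))))//.
rewrite -ge0_integralZl//.
- apply: eq_integral => t _.
  by rewrite affine_tuple_cons big_ord_recl EFinM muleA.
- apply: emeasurable_funM => //.
  by apply: (measurableT_comp (mc _)) => //; exact: measurable_affine_tuple.
- by move=> t _; rewrite mule_ge0// lee_fin pu0.
- by rewrite lee_fin ltW.
Qed.

End affine_invariance.

(** * Integration by parts along a flow *)

Section flow.
Context {R : realType} d (T : measurableType d).
Variable mu : {sigma_finite_measure set T -> \bar R}.
Local Open Scope ereal_scope.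

(** The invariance is assumed for nonnegative functions; it passes to
    integrable ones through the positive and negative parts. *)
Lemma integral_change_variable (Phi : T -> T) (J : R) (f : T -> R) :
  (0 <= J)%R -> measurable_fun setT Phi ->
  (forall g : T -> \bar R, measurable_fun setT g -> (forall t, 0 <= g t) ->
    \int[mu]_t (J%:E * g (Phi t)) = \int[mu]_t g t) ->
  mu.-integrable setT (EFin \o f) ->
  mu.-integrable setT (fun t => (J * f (Phi t))%:E) /\
  \int[mu]_t (J * f (Phi t))%:E = \int[mu]_t (f t)%:E.
Proof.
move=> J0 mPhi inv intf; have mf := measurable_int _ intf.
have mfPhi : measurable_fun setT (fun t => (f (Phi t))%:E).
  exact: (measurableT_comp mf mPhi).
have invf (g : \bar R -> \bar R) : measurable_fun setT g -> (forall x, 0 <= g x) ->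
    \int[mu]_t (J%:E * g (f (Phi t))%:E) = \int[mu]_t g (f t)%:E.
  move=> mg g0; apply: (inv (fun t => g (f t)%:E)) => //.
  exact: (measurableT_comp mg mf).
have intJf : mu.-integrable setT (fun t => (J * f (Phi t))%:E).
  apply/integrableP; split.
    by under eq_fun do rewrite EFinM; exact: measurable_funeM.
  under eq_integral do rewrite EFinM abseM (gee0_abs (x := J%:E))//.
  by rewrite (invf abse)//; case/integrableP : intf.
split => //; rewrite [LHS]integralE [RHS]integralE; congr (_ - _).
- transitivity (\int[mu]_t (J%:E * maxe (f (Phi t))%:E 0)).
    by apply: eq_integral => t _; rewrite funeposE EFinM maxe_pMr// mule0.
  transitivity (\int[mu]_t maxe (f t)%:E 0); last first.
    by apply: eq_integral => t _; rewrite funeposE.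
  apply: (invf (fun x => maxe x 0)) => [|x]; first exact: measurable_maxe.
  by rewrite le_max lexx orbT.
- transitivity (\int[mu]_t (J%:E * maxe (- (f (Phi t))%:E) 0)).
    by apply: eq_integral => t _; rewrite funenegE EFinM -muleN maxe_pMr// mule0.
  transitivity (\int[mu]_t maxe (- (f t)%:E) 0); last first.
    by apply: eq_integral => t _; rewrite funenegE.
  apply: (invf (fun x => maxe (- x) 0)) => [|x]; last by rewrite le_max lexx orbT.
  by apply: measurable_maxe => //; exact: oppe_measurable.
Qed.

(** By the invariance, the integral of J_s F(Phi_s t) does not depend on s.
    Writing its increment from s = 0 to s = 1 as the integral over t and s of the
    derivative J_s G(Phi_s t), and exchanging the two integrals, leaves the
    integral over [0, 1] of the integral of G. It is integrability alone, and not
    decay at infinity, that makes the boundary terms of an integration by parts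
    disappear. *)
Lemma integral_flow0 (Phi : R -> T -> T) (J : R -> R) (F G : T -> R) :
  measurable_fun setT (fun z : measurableTypeR R * T => Phi z.1 z.2) ->
  measurable_fun setT J -> (forall s, 0 <= J s)%R ->
  (forall s (g : T -> \bar R), measurable_fun setT g -> (forall t, 0 <= g t) ->
    \int[mu]_t ((J s)%:E * g (Phi s t)) = \int[mu]_t g t) ->
  mu.-integrable setT (EFin \o F) -> mu.-integrable setT (EFin \o G) ->
  (forall t (s : R), is_derive s (1%R : R) (fun s : R => J s * F (Phi s t) : R)%R (J s * G (Phi s t))%R) ->
  (forall t, continuous (fun s : R => J s * G (Phi s t))%R) ->
  \int[mu]_t (G t)%:E = 0.
Proof.
move=> mPhi mJ J0 inv intF intG dF cG.
have mPhis s : measurable_fun setT (Phi s).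
  exact: (measurableT_comp mPhi (measurable_pair1 s)).
have cvF s := integral_change_variable (J0 s) (mPhis s) (inv s) intF.
have cvG s := integral_change_variable (J0 s) (mPhis s) (inv s) intG.
(* the increment over [0, 1] is written as an integral over the whole line,
   so that Fubini applies to a product of two sigma-finite measures *)
pose I01 : set R := `[0%R, 1%R]%classic.
pose H (z : measurableTypeR R * T) := (\1_I01 z.1 * (J z.1 * G (Phi z.1 z.2)))%R.
have mI01 : measurable (I01 : set (measurableTypeR R)) by exact: measurable_itv.
have m1 : measurable_fun setT (\1_I01 : measurableTypeR R -> R).
  exact: measurable_indic.
have int1 : \int[lebesgue_measure]_(s in (setT : set (measurableTypeR R))) (\1_I01 s)%:E = 1.
  rewrite integral_indic// setIT.
  transitivity (@lebesgue_measure R [set` `[0%R, 1%R] : interval R]) => //.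
  by rewrite lebesgue_measure_itv/= lte_fin ltr01 oppr0 adde0.
have mH : measurable_fun setT (EFin \o H).
  apply/measurable_EFinP; apply: measurable_funM.
    exact: (measurableT_comp m1 measurable_fst).
  apply: measurable_funM; first exact: (measurableT_comp mJ measurable_fst).
  have /measurable_EFinP mG := measurable_int _ intG.
  exact: (measurableT_comp mG mPhi).
have intH : (lebesgue_measure \x mu).-integrable setT (EFin \o H).
  apply/integrable12ltyP => //.
  rewrite (eq_integral (fun s : measurableTypeR R => (\1_I01 s)%:E * \int[mu]_t `|(G t)%:E|)); last first.
    move=> s _; rewrite -(inv s (fun t => `|(G t)%:E|))//; last first.
      by apply: measurableT_comp => //; exact: measurable_int intG.
    rewrite -ge0_integralZl//; last 2 first.
    - apply: measurable_funeM; apply: measurableT_comp => //.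
      exact: (measurableT_comp (measurable_int _ intG)).
    - by move=> t _; rewrite mule_ge0// lee_fin.
    apply: eq_integral => t _.
    rewrite /H /= normrM normrM !EFinM; congr (_ * (_ * _)).
      by rewrite ger0_norm.
    by rewrite ger0_norm.
  rewrite ge0_integralZr//; last 2 first.
  - exact/measurable_EFinP.
  - exact: integral_ge0.
  rewrite int1 mul1e.
  by case/integrableP : intG.
have := Fubini intH.
rewrite [LHS](_ : _ = \int[mu]_t (G t)%:E); last first.
  rewrite (eq_integral (fun s : measurableTypeR R => (\1_I01 s)%:E * \int[mu]_t (G t)%:E)); last first.
    move=> s _; rewrite -(cvG s).2 -integralZl//; last exact: (cvG s).1.
  have /fineK <- : \int[mu]_t (G t)%:E \is a fin_num by exact: integrable_fin_num.
  rewrite integralZr//; first by rewrite int1 mul1e.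
  apply/integrableP; split; first exact/measurable_EFinP.
  under eq_integral do rewrite gee0_abs ?lee_fin//.
  by rewrite int1 ltry.
move=> ->; rewrite (eq_integral (fun t => (J 1 * F (Phi 1 t))%:E - (J 0 * F (Phi 0 t))%:E)).
  rewrite integralB//; [|exact: (cvF _).1..].
  rewrite (cvF 1%R).2 (cvF 0%R).2 subee//; exact: integrable_fin_num.
move=> t _.
have contF : continuous (fun s => J s * F (Phi s t) : R)%R.
  move=> s; apply/differentiable_continuous/derivable1_diffP.
  exact: (@ex_derive _ _ _ _ _ _ _ (dF t s)).
rewrite -(@continuous_FTC2 _ (fun s => J s * G (Phi s t))%R (fun s => J s * F (Phi s t))%R)//.
- rewrite [RHS]integral_mkcond; apply: eq_integral => s _.
  rewrite /H /= /patch /I01 indicE; case: ifP => _; first by rewrite mul1r.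
  by rewrite mul0r.
- exact: continuous_subspaceT.
- split.
  + by move=> s _; exact: (@ex_derive _ _ _ _ _ _ _ (dF t s)).
  + exact/cvg_at_right_filter/contF.
  + exact/cvg_at_left_filter/contF.
- by move=> s _; rewrite derive1E derive_val.
Qed.
End flow.

(** * Integrable real-valued functions *)

Section integrable_real.
Context {R : realType} d (T : measurableType d).
Variable mu : {measure set T -> \bar R}.
Implicit Types f g : T -> R.

Definition integrable_fun f := mu.-integrable setT (EFin \o f).

Lemma integrable_funP f : measurable_fun setT f ->
  (\int[mu]_t (`|f t|)%:E < +oo)%E -> integrable_fun f.
Proof. by move=> mf foo; apply/integrableP; split => //; exact/measurable_EFinP. Qed.

Lemma integrable_fun_measurable f : integrable_fun f -> measurable_fun setT f.
Proof. by move=> /measurable_int/measurable_EFinP. Qed.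

Lemma integrable_fun_le f g : measurable_fun setT f -> integrable_fun g ->
  (forall t, `|f t| <= g t) -> integrable_fun f.
Proof.
move=> mf ig fg; apply: le_integrable ig => //; first exact/measurable_EFinP.
by move=> t _ /=; rewrite lee_fin (le_trans (fg t))// ler_norm.
Qed.

Lemma integrable_funD f g : integrable_fun f -> integrable_fun g ->
  integrable_fun (fun t => f t + g t).
Proof. exact: integrableD. Qed.

Lemma integrable_funB f g : integrable_fun f -> integrable_fun g ->
  integrable_fun (fun t => f t - g t).
Proof. exact: integrableB. Qed.

Lemma integrable_funZ c f : integrable_fun f -> integrable_fun (fun t => c * f t).
Proof. exact: integrableZl. Qed.

Lemma integrable_fun_norm f : integrable_fun f -> integrable_fun (fun t => `|f t|).
Proof. exact: integrable_norm. Qed.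

Lemma integrable_fun_sum (I : finType) (f : I -> T -> R) :
  (forall i, integrable_fun (f i)) -> integrable_fun (fun t => \sum_i f i t).
Proof.
move=> intf; rewrite /integrable_fun.
rewrite (_ : _ \o _ = fun t => (\sum_i (f i t)%:E)%E).
  by apply: integrable_sum => // i _; exact: intf.
by apply/funext => t /=; rewrite sumEFin.
Qed.

Lemma Rintegral_sum (I : finType) (f : I -> T -> R) :
  (forall i, integrable_fun (f i)) ->
  \int[mu]_t (\sum_i f i t) = \sum_i \int[mu]_t f i t.
Proof.
move=> intf; rewrite /Rintegral.
under eq_integral do rewrite -sumEFin.
rewrite integral_sum//.
rewrite (eq_bigr (fun i => (\int[mu]_t f i t)%:E)) ?sumEFin// => i _.
by rewrite fineK//; exact/integrable_fin_num/intf.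
Qed.

(** Monotone convergence, in the form used to remove a cutoff: a uniform bound
    on the integrals makes the limit integrable. *)
Lemma integrable_fun_limit (f_ : nat -> T -> R) f C :
  (forall n, measurable_fun setT (f_ n)) -> measurable_fun setT f ->
  (forall n t, 0 <= f_ n t) -> (forall t, {homo f_ ^~ t : n m / (n <= m)%N >-> n <= m}) ->
  (forall t, f_ n t @[n --> \oo] --> f t) ->
  (forall n, (\int[mu]_t (f_ n t)%:E <= C%:E)%E) -> integrable_fun f.
Proof.
move=> mf_ mf f_0 ndf f_f leC; apply: integrable_funP => //.
apply: (@le_lt_trans _ _ C%:E); last exact: ltry.
have f0 t : 0 <= f t.
  by apply: (cvgr_to_ge (f_f t)) => //; apply: nearW => n.
rewrite (eq_integral (fun t => (f t)%:E)); last by move=> t _; rewrite ger0_norm.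
have cvgI : (\int[mu]_t (f_ n t)%:E @[n --> \oo] --> \int[mu]_t (f t)%:E)%E.
  rewrite (eq_integral (fun t => limn (fun n => (f_ n t)%:E))); last first.
    move=> t _; apply/esym/cvg_lim => //.
    by apply: cvg_EFin; [exact: nearW|exact: f_f].
  apply: (cvg_monotone_convergence measurableT) => [n|n t _|t _ n m nm].
  - exact/measurable_EFinP.
  - by rewrite lee_fin.
  - by rewrite lee_fin ndf.
by apply: (cvge_to_le cvgI) => //; apply: nearW.
Qed.

Lemma measurable_funV f : measurable_fun setT f -> measurable_fun setT (fun t => (f t)^-1).
Proof.
move=> mf; rewrite (_ : (fun _ => _) = fun t => f t * (f t ^+ 2) `^ (-1)).
  apply: measurable_funM => //.
  apply: (measurableT_comp (@measurable_powR R (-1))).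
  exact: measurable_funX.
apply/funext => t; rewrite powR_inv1 ?sqr_ge0// expr2.
have [->|f0] := eqVneq (f t) 0; first by rewrite invr0 mul0r.
by rewrite invfM mulrA mulfV// mul1r.
Qed.

End integrable_real.

(** * One column of parameters and its density *)

Section column.
Context {R : realType} (n m : nat).
Variables (a : 'I_n) (b : 'I_m -> 'I_n) (Q : 'M[R]_m) (c : 'cV[R]_m) (s alpha : R).
Hypotheses (b_inj : injective b) (bNa : forall k, b k != a).
Hypothesis Q_posdef : posdefmx Q.

Implicit Types (t : n.-tuple R) (h : n.-tuple R -> R).

Let leb := @lebesgue_tuple R n.

(** The coordinate [a] of a tuple is D_ii, and the coordinates [b k] are the
    entries L_ki of the parents k of i. The vector [c] is m_i. *)
Definition col_diag t : R := tnth t a.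
Definition col_dev t : 'cV[R]_m := \col_k (tnth t (b k) + c k 0).
Definition quad_form (v : 'cV[R]_m) : R := (v^T *m Q *m v) 0 0.
(** The factor x^(-alpha/2) exp(-(s + y^T Q y)/(2x)) of the density that
    involves the column, with the power written as an exponential. *)
Definition col_kernel t : R :=
  if 0 < col_diag t then
    expR (- ((s + quad_form (col_dev t)) / (2 * col_diag t)) - alpha / 2 * ln (col_diag t))
  else 0.

Definition off_column h := forall t t',
  (forall j, j != a -> (forall k, j != b k) -> tnth t j = tnth t' j) -> h t = h t'.

(** The affine map sending x to cx x and the deviation y = l + c to cy y + z,
    and fixing the other coordinates. *)
Definition col_map (cx cy : R) (z : 'cV[R]_m) : n.-tuple R -> n.-tuple R :=
  affine_tuple
    (fun j => if j == a then cx else if [pick k | b k == j] is Some _ then cy else 1)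
    (fun j => if [pick k | b k == j] is Some k then (cy - 1) * c k 0 + z k 0 else 0).

Lemma pick_b k : [pick k' | b k' == b k] = Some k.
Proof. by case: pickP => [k' /eqP/b_inj -> //|/(_ k)]; rewrite eqxx. Qed.

Lemma pick_a : [pick k' | b k' == a] = None.
Proof. by case: pickP => // k; rewrite (negbTE (bNa k)). Qed.

Lemma col_diag_map cx cy z t : col_diag (col_map cx cy z t) = cx * col_diag t.
Proof. by rewrite /col_diag tnth_mktuple eqxx pick_a addr0. Qed.

Lemma col_dev_map cx cy z t : col_dev (col_map cx cy z t) = cy *: col_dev t + z.
Proof.
apply/colP => k; rewrite !mxE tnth_mktuple (negbTE (bNa k)) pick_b; ring.
Qed.

Lemma off_column_map h cx cy z t : off_column h -> h (col_map cx cy z t) = h t.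
Proof.
move=> hoff; apply: hoff => j ja jb; rewrite tnth_mktuple (negbTE ja).
case: pickP => [k /eqP bk|_]; last by rewrite mul1r addr0.
by have := jb k; rewrite bk eqxx.
Qed.

Lemma ge0_integral_col_map cx cy z (g : n.-tuple R -> \bar R) :
  0 < cx -> 0 < cy -> measurable_fun setT g -> (forall t, (0 <= g t)%E) ->
  (\int[leb]_t ((cx * cy ^+ m)%:E * g (col_map cx cy z t)) = \int[leb]_t g t)%E.
Proof.
move=> cx0 cy0 mg g0.
set u := fun j => if j == a then cx else if [pick k | b k == j] is Some _ then cy else 1.
have u0 j : 0 < u j by rewrite /u; case: (j == a) => //; case: [pick k | b k == j].
rewrite -(ge0_integral_affine_tuple (fun j =>
  if [pick k | b k == j] is Some k then (cy - 1) * c k 0 + z k 0 else 0) u0 mg g0).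
suff -> : \prod_j u j = cx * cy ^+ m by [].
rewrite (bigD1 a)//= {1}/u eqxx; congr (_ * _).
rewrite -[in RHS](card_ord m) -(card_codom b_inj) -prodr_const.
rewrite big_mkcond [RHS]big_mkcond; apply: eq_bigr => j _.
have [->|ja] := eqVneq j a.
  by case: ifPn => // /codomP[k ak]; have := bNa k; rewrite -ak eqxx.
rewrite /u (negbTE ja); case: pickP => [k /eqP <-|bj]; first by rewrite codom_f.
by case: ifPn => // /codomP[k jk]; have := bj k; rewrite jk eqxx.
Qed.

Lemma measurable_col_map (cx cy : R -> R) (z : R -> 'cV[R]_m) :
  measurable_fun setT cx -> measurable_fun setT cy ->
  (forall k, measurable_fun setT (fun u => z u k 0)) ->
  measurable_fun setT (fun v : measurableTypeR R * n.-tuple R =>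
    col_map (cx v.1) (cy v.1) (z v.1) v.2).
Proof.
move=> mcx mcy mz; apply/measurable_fun_tnthP => j.
pose u (x : measurableTypeR R) : R :=
  if j == a then cx x else if [pick k | b k == j] is Some _ then cy x else 1.
pose w (x : measurableTypeR R) : R :=
  if [pick k | b k == j] is Some k then (cy x - 1) * c k 0 + z x k 0 else 0.
rewrite (_ : _ \o _ = fun v => u v.1 * tnth v.2 j + w v.1); last first.
  by apply/funext => v /=; rewrite tnth_mktuple.
have mu : measurable_fun setT u by rewrite /u; case: (j == a) => //; case: [pick k | b k == j].
have mw : measurable_fun setT w.
  rewrite /w; case: [pick k | b k == j] => // k; apply: measurable_funD; last exact: mz.
  by apply: measurable_funM => //; apply: measurable_funB.
apply: measurable_funD; last exact: (measurableT_comp mw measurable_fst).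
apply: measurable_funM; first exact: (measurableT_comp mu measurable_fst).
exact: (measurableT_comp (measurable_tnth j) measurable_snd).
Qed.

Lemma measurable_col_diag : measurable_fun setT col_diag.
Proof. exact: measurable_tnth. Qed.

Lemma measurable_col_dev k : measurable_fun setT (fun t => col_dev t k 0).
Proof.
rewrite (_ : (fun _ => _) = fun t => tnth t (b k) + c k 0).
  by apply: measurable_funD => //; exact: measurable_tnth.
by apply/funext => t; rewrite mxE.
Qed.

Lemma measurable_Q_col_dev k : measurable_fun setT (fun t => (Q *m col_dev t) k 0).
Proof.
rewrite (_ : (fun _ => _) = fun t => \sum_j Q k j * col_dev t j 0).
  apply: measurable_sum => j; apply: measurable_funM => //.
  exact: measurable_col_dev.
by apply/funext => t; rewrite mxE.
Qed.

Lemma quad_formE v : quad_form v = \sum_k v k 0 * (Q *m v) k 0.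
Proof. by rewrite /quad_form -mulmxA mxE; apply: eq_bigr => k _; rewrite mxE. Qed.

Lemma measurable_quad_form : measurable_fun setT (fun t => quad_form (col_dev t)).
Proof.
under eq_fun do rewrite quad_formE.
apply: measurable_sum => j; apply: measurable_funM.
  exact: measurable_col_dev.
exact: measurable_Q_col_dev.
Qed.

Lemma measurable_col_kernel : measurable_fun setT col_kernel.
Proof.
apply: measurable_fun_ifT => //.
  by apply: measurable_fun_ltr => //; exact: measurable_col_diag.
apply: (measurableT_comp (@measurable_expR R)).
apply: measurable_funB; last first.
  apply: measurable_funM => //.
  exact: (measurableT_comp (@measurable_ln R) measurable_col_diag).
apply: measurable_funN; apply: measurable_funM.
  by apply: measurable_funD => //; exact: measurable_quad_form.
apply: measurable_funV; apply: measurable_funM => //; exact: measurable_col_diag.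
Qed.

Lemma col_kernel_ge0 t : 0 <= col_kernel t.
Proof. by rewrite /col_kernel; case: ifP => // _; exact: expR_ge0. Qed.

Lemma quad_form_ge0 v : 0 <= quad_form v.
Proof.
have [->|v0] := eqVneq v 0; first by rewrite /quad_form mulmx0 mxE.
exact/ltW/Q_posdef.2.
Qed.

Lemma quad_formZ e v : quad_form (e *: v) = e ^+ 2 * quad_form v.
Proof.
by rewrite /quad_form [(e *: v)^T]linearZ/= -!scalemxAl -scalemxAr scalerA mxE expr2.
Qed.

Lemma quad_formD v z : quad_form (v + z) = quad_form v + 2 * (z^T *m (Q *m v)) 0 0 + quad_form z.
Proof.
rewrite /quad_form [(v + z)^T]linearD/= mulmxDl !mulmxDr !mulmxDl.
rewrite [in LHS](_ : v^T *m Q *m z = (z^T *m (Q *m v))^T); last first.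
  by rewrite !trmx_mul trmxK Q_posdef.1.
have addE (A B : 'M[R]_1) : (A + B) 0 0 = A 0 0 + B 0 0 by rewrite mxE.
have trE (A : 'M[R]_1) : A^T 0 0 = A 0 0 by rewrite mxE.
rewrite !addE trE mulmxA; ring.
Qed.

Lemma posdefmx_unit : Q \in unitmx.
Proof.
rewrite -row_free_unit -kermx_eq0; apply: contraT => /rowV0Pn[v /sub_kermxP vQ v0].
have := Q_posdef.2 v^T; rewrite trmx_eq0 trmxK vQ mul0mx mxE ltxx.
by move=> /(_ v0).
Qed.

(** Cauchy-Schwarz for the scalar product of Q, applied to v and Q^-1 e_j,
    whose product is v_j. It lets the quadratic form of the kernel control the
    deviations one by one. *)
Lemma quad_form_ge_coord (v : 'cV[R]_m) j : v j 0 ^+ 2 <= invmx Q j j * quad_form v.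
Proof.
pose e : 'cV[R]_m := invmx Q *m delta_mx j 0.
have Qe : Q *m e = delta_mx j 0 by rewrite mulKVmx// posdefmx_unit.
have quad_e : quad_form e = invmx Q j j.
  rewrite /quad_form -mulmxA Qe -colE mxE mxE.
  by rewrite /e -colE mxE.
clearbody e.
(* the value of the form at v - r e; the minimum over r is at r = v_j / q *)
have ve r : 0 <= quad_form v - 2 * (r * v j 0) + r ^+ 2 * invmx Q j j.
  have := quad_form_ge0 (v + (- r) *: e).
  rewrite quad_formD quad_formZ quad_e sqrrN [(_ *: e)^T]linearZ/= -scalemxAl mxE.
  rewrite mulmxA (_ : e^T *m Q = (delta_mx j 0)^T); last first.
    by rewrite -Qe trmx_mul Q_posdef.1.
  by rewrite trmx_delta -rowE !mxE mulNr mulrN.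
have k0 : 0 < invmx Q j j.
  rewrite -quad_e; apply: Q_posdef.2; apply/eqP => e0.
  have /matrixP/(_ j 0) := Qe; rewrite e0 mulmx0 !mxE !eqxx => /eqP.
  by rewrite eq_sym oner_eq0.
have := ve (v j 0 / invmx Q j j); set q := invmx Q j j in k0 *.
have -> : quad_form v - 2 * (v j 0 / q * v j 0) + (v j 0 / q) ^+ 2 * q =
  (q * quad_form v - v j 0 ^+ 2) / q by field; rewrite gt_eqF.
by rewrite pmulr_lge0 ?invr_gt0// subr_ge0.
Qed.

End column.

(** * Derivatives along the scaling and translation flows *)

Section scalar_flow.
Context {R : realType}.
Implicit Types (x p q eps u : R).

Lemma is_derive_expRN2 u : is_derive u (1 : R) (fun v : R => expR (- (2 * v)) : R) (- (2 * expR (- (2 * u)))).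
Proof.
have d : is_derive u (1 : R) (fun v : R => - (2 * v) : R) (- 2).
  by apply: is_derive_eq; rewrite scaler1.
have := @is_derive1_comp _ expR (fun v : R => - (2 * v)) u _ _ (is_derive_expR _) d.
by move/is_derive_eq; apply; rewrite mulrC mulNr.
Qed.

(** Along the scaling flow exp(-2v) is the natural parameter: the quadratic
    term of the exponent is invariant, s/(2x) becomes s exp(-2v)/(2x), and the
    cutoff becomes x / (exp(-2v) + eps x). *)
Lemma is_derive_scaling x p q eps u : 0 < x -> 0 <= eps ->
  is_derive u (1 : R)
    (fun v : R => expR (p * v - q * expR (- (2 * v))) * (x / (expR (- (2 * v)) + eps * x)) : R)
    (expR (p * u - q * expR (- (2 * u))) *
      (2 * (x * expR (- (2 * u)) / (expR (- (2 * u)) + eps * x) ^+ 2) +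
       p * (x / (expR (- (2 * u)) + eps * x)) +
       2 * q * x * (expR (- (2 * u)) / (expR (- (2 * u)) + eps * x)))).
Proof.
move=> x0 eps0.
have dr := is_derive_expRN2 u.
have r0 : 0 < expR (- (2 * u)) by exact: expR_gt0.
have dA : is_derive u (1 : R) (fun v : R => p * v - q * expR (- (2 * v)) : R)
    (p + 2 * q * expR (- (2 * u))).
  have d1 : is_derive u (1 : R) (fun v : R => p * v : R) p.
    by apply: is_derive_eq; rewrite scaler1.
  have d2 := is_deriveZ q dr.
  have := is_deriveB d1 d2; move/is_derive_eq; apply.
  by rewrite /GRing.scale/= ?/GRing.scale/=; ring.
have dE := @is_derive1_comp _ expR _ u _ _ (is_derive_expR _) dA.
have rx0 : expR (- (2 * u)) + eps * x != 0.
  by rewrite gt_eqF// ltr_pwDl// mulr_ge0// ltW.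
have dS : is_derive u (1 : R) (fun v : R => expR (- (2 * v)) + eps * x : R) (- (2 * expR (- (2 * u)))).
  have := is_deriveD dr (is_derive_cst (eps * x) u 1); move/is_derive_eq; apply.
  by rewrite addr0.
have dV := is_deriveZ x (@is_deriveV _ (fun v : R => expR (- (2 * v)) + eps * x : R) u _ 1 rx0 dS).
have := is_deriveM dE dV; move/is_derive_eq; apply.
by rewrite /GRing.scale/= /GRing.scale/=; field.
Qed.

Lemma continuous_scaling x p q q' eps : 0 < x -> 0 <= eps ->
  continuous (fun v : R => expR (p * v - q * expR (- (2 * v))) *
      (2 * (x * expR (- (2 * v)) / (expR (- (2 * v)) + eps * x) ^+ 2) +
       p * (x / (expR (- (2 * v)) + eps * x)) +
       q' * (expR (- (2 * v)) / (expR (- (2 * v)) + eps * x))) : R).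
Proof.
move=> x0 eps0.
have cr : continuous (fun v : R => expR (- (2 * v)) : R).
  move=> v; apply/differentiable_continuous/derivable1_diffP.
  exact: (@ex_derive _ _ _ _ _ _ _ (is_derive_expRN2 v)).
have cI : continuous (fun v : R => (expR (- (2 * v)) + eps * x)^-1 : R).
  move=> v; apply: cvgV; first by rewrite gt_eqF// ltr_pwDl ?expR_gt0// mulr_ge0// ltW.
  by apply: cvgD; [exact: cr|exact: cvg_cst].
have cE : continuous (fun v : R => expR (p * v - q * expR (- (2 * v))) : R).
  move=> v; apply: continuous_comp; last exact: continuous_expR.
  by apply: cvgB; apply: cvgMl_tmp; [exact: cvg_id|exact: cr].
move=> v; apply: cvgM; first exact: cE.
apply: cvgD; first apply: cvgD; apply: cvgMl_tmp.
- apply: cvgM; first by apply: cvgMl_tmp; exact: cr.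
  under eq_fun do rewrite -exprVn expr2; rewrite -exprVn expr2.
  by apply: cvgM; exact: cI.
- by apply: cvgMl_tmp; exact: cI.
- by apply: cvgM; [exact: cr|exact: cI].
Qed.

(** Along a translation of one coordinate the exponent is a polynomial of
    degree 2 in the parameter, and the function in front is affine. *)
Lemma is_derive_translation (A B C e f : R) u :
  is_derive u (1 : R)
    (fun v : R => expR (- (A + B * v + C * v ^+ 2)) * (e + f * v) : R)
    (expR (- (A + B * u + C * u ^+ 2)) * (f - (B + 2 * C * u) * (e + f * u))).
Proof.
have dZ (g : R) : is_derive u (1 : R) (fun v : R => g * v : R) g.
  by apply: is_derive_eq; rewrite scaler1.
have dC : is_derive u (1 : R) (fun v : R => C * v ^+ 2 : R) (2 * C * u).
  have := is_deriveZ C (is_deriveM (is_derive_id u (1 : R)) (is_derive_id u 1)).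
  by move/is_derive_eq; apply; rewrite /GRing.scale/= ?/GRing.scale/=; ring.
have dA := is_deriveN (is_deriveD (is_deriveD (is_derive_cst A u 1) (dZ B)) dC).
have dE := @is_derive1_comp _ expR _ u _ _ (is_derive_expR _) dA.
have := is_deriveM dE (is_deriveD (is_derive_cst e u 1) (dZ f)).
move/is_derive_eq; apply.
set E := expR (- _).
by change (E * (0 + f) + (e + f * u) * (E * - (0 + B + 2 * C * u)) =
  E * (f - (B + 2 * C * u) * (e + f * u))); ring.
Qed.

Lemma continuous_translation (A B C e f : R) :
  continuous (fun v : R =>
    expR (- (A + B * v + C * v ^+ 2)) * (f - (B + 2 * C * v) * (e + f * v)) : R).
Proof.
have cl (g l : R) : continuous (fun v : R => g + l * v : R).
  by move=> v; apply: cvgD; [exact: cvg_cst|apply: cvgMl_tmp; exact: cvg_id].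
move=> v; apply: cvgM; last first.
  by apply: cvgB; [exact: cvg_cst|apply: cvgM; exact: cl].
apply: continuous_comp; last exact: continuous_expR.
apply: cvgN; apply: cvgD; first exact: cl.
apply: cvgMl_tmp.
under eq_fun do rewrite expr2; rewrite expr2.
by apply: cvgM; exact: cvg_id.
Qed.
End scalar_flow.

(** * Moments of one column *)

Section moments.
Context {R : realType} (n m : nat).
Variables (a : 'I_n) (b : 'I_m -> 'I_n) (Q : 'M[R]_m) (c : 'cV[R]_m) (s alpha : R).
Hypotheses (b_inj : injective b) (bNa : forall k, b k != a).
Hypothesis Q_posdef : posdefmx Q.

Implicit Types (t : n.-tuple R) (h : n.-tuple R -> R).

Let leb := @lebesgue_tuple R n.
Local Notation x := (col_diag a).
Local Notation y := (col_dev b c).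
Local Notation w t := (quad_form Q (col_dev b c t)).
Local Notation k := (col_kernel a b Q c s alpha).
Local Notation intR := (integrable_fun leb).
Local Notation p := (m%:R + 2 - alpha).

Let mx : measurable_fun setT (x : n.-tuple R -> R). Proof. exact: measurable_col_diag. Qed.
Let my j : measurable_fun setT (fun t => y t j 0). Proof. exact: measurable_col_dev. Qed.
Let mQy j : measurable_fun setT (fun t => (Q *m y t) j 0).
Proof. exact: measurable_Q_col_dev. Qed.
Let mk : measurable_fun setT k. Proof. exact: measurable_col_kernel. Qed.
Let mw : measurable_fun setT (fun t => w t). Proof. exact: measurable_quad_form. Qed.

Lemma col_kernel_map cx cy z t : 0 < cx -> 0 < x t ->
  k (col_map a b c cx cy z t) =
  expR (- ((s + quad_form Q (cy *: y t + z)) / (2 * (cx * x t))) -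
        alpha / 2 * (ln cx + ln (x t))).
Proof.
by move=> cx0 xt0; rewrite /col_kernel col_diag_map// col_dev_map// mulr_gt0// lnM.
Qed.

Lemma col_kernel_map0 cx cy z t : 0 < cx -> x t <= 0 -> k (col_map a b c cx cy z t) = 0.
Proof.
by move=> cx0 xt0; rewrite /col_kernel col_diag_map// pmulr_rgt0// ltNge xt0.
Qed.

Lemma col_kernel0 t : x t <= 0 -> k t = 0.
Proof. by move=> xt0; rewrite /col_kernel ltNge xt0. Qed.

(** The exponent p = m + 2 - alpha collects the Jacobian exp((m + 2) u) and
    the factor exp(- alpha u) from the power of x. *)
Lemma col_kernel_scaling u t : 0 < x t ->
  expR (2 * u) * expR u ^+ m * k (col_map a b c (expR (2 * u)) (expR u) 0 t) =
  expR (- (w t / (2 * x t)) - alpha / 2 * ln (x t)) *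
  expR (p * u - s / (2 * x t) * expR (- (2 * u))).
Proof.
move=> xt0; rewrite col_kernel_map ?expR_gt0// addr0 quad_formZ expRK.
rewrite -expRM_natl -!expRD; congr expR.
have -> : expR u ^+ 2 = expR (2 * u) by rewrite -expRM_natl.
rewrite expRN; set r := expR _; have r0 : r != 0 by rewrite gt_eqF// expR_gt0.
by field; rewrite r0 gt_eqF.
Qed.

(** Integration by parts for F = H x along the scaling flow, where x is
    replaced by x / (1 + eps x), because only the integrability of the kernel is
    known at first. The case eps = 0 is the exact identity. *)
Lemma integral_scaling h eps : 0 <= eps ->
  measurable_fun setT h -> off_column a b h -> intR (fun t => h t * k t) ->
  intR (fun t => h t * (k t * (x t / (1 + eps * x t)))) ->
  intR (fun t => h t * (k t * (2 * (x t / (1 + eps * x t) ^+ 2) +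
    p * (x t / (1 + eps * x t)) + s / (1 + eps * x t)))) /\
  \int[leb]_t (h t * (k t * (2 * (x t / (1 + eps * x t) ^+ 2) +
    p * (x t / (1 + eps * x t)) + s / (1 + eps * x t)))) = 0.
Proof.
move=> eps0 mh hoff inthk intF; set F := fun t => _ in intF; set G := fun t => _.
have mden : measurable_fun setT (fun t => (1 + eps * x t)^-1).
  apply: measurable_funV; apply: measurable_funD => //.
  by apply: measurable_funM.
have mG : measurable_fun setT G.
  apply: measurable_funM => //; apply: measurable_funM => //.
  apply: measurable_funD; last by apply: measurable_funM.
  apply: measurable_funD; last by apply: measurable_funM => //; apply: measurable_funM.
  apply: measurable_funM => //; apply: measurable_funM => //.
  by under eq_fun do rewrite -exprVn; exact: measurable_funX.
have intG : intR G.
  apply: (@integrable_fun_le _ _ _ leb _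
    (fun t => (2 + `|p|) * `|F t| + `|s| * `|h t * k t|)) => //.
    by apply: integrable_funD; apply: integrable_funZ; exact: integrable_fun_norm.
  move=> t; rewrite /G /F !normrM.
  have [xt0|xt0] := leP (x t) 0; first by rewrite col_kernel0// normr0 !(mul0r, mulr0) addr0.
  have d1 : 1 <= 1 + eps * x t by rewrite lerDl mulr_ge0// ltW.
  have d0 : 0 < 1 + eps * x t by exact: lt_le_trans d1.
  rewrite (ger0_norm (ltW xt0)) (gtr0_norm (x := (1 + _)^-1)) ?invr_gt0//.
  rewrite (_ : _ + _ = (`|h t| * `|k t|) * ((2 + `|p|) * (x t / (1 + eps * x t)) + `|s|)); last by ring.
  rewrite mulrA ler_wpM2l ?mulr_ge0//.
  set d := (1 + eps * x t)^-1; have d_ge0 : 0 <= d by rewrite invr_ge0 ltW.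
  have d_le1 : d <= 1 by rewrite invf_le1.
  rewrite -exprVn -/d (le_trans (ler_normD _ _))// lerD//; last first.
    by rewrite normrM (ger0_norm d_ge0) ler_piMr.
  have xd0 : 0 <= x t * d by rewrite mulr_ge0// ltW.
  rewrite (mulrDl 2 `|p|) (le_trans (ler_normD _ _))// lerD//; last by rewrite normrM (ger0_norm xd0).
  have -> : x t * d ^+ 2 = (x t * d) * d by ring.
  have nn : 0 <= 2 * (x t * d * d) by rewrite !mulr_ge0// ltW.
  by rewrite (ger0_norm nn); apply: ler_wpM2l => //; rewrite ler_piMr.
(* the part of the kernel that is constant along the flow *)
pose K t := h t * expR (- (w t / (2 * x t)) - alpha / 2 * ln (x t)).
have KE u t A : 0 < x t ->
    expR (2 * u) * expR u ^+ m *
      (h (col_map a b c (expR (2 * u)) (expR u) 0 t) *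
       (k (col_map a b c (expR (2 * u)) (expR u) 0 t) * A)) =
    K t * (expR (p * u - s / (2 * x t) * expR (- (2 * u))) * A).
  move=> xt0; rewrite off_column_map//.
  transitivity (h t * (expR (2 * u) * expR u ^+ m *
    k (col_map a b c (expR (2 * u)) (expR u) 0 t)) * A); first by ring.
  by rewrite col_kernel_scaling// /K; ring.
have expR2N u : expR (2 * u) = (expR (- (2 * u)))^-1 by rewrite expRN invrK.
have FE u t : 0 < x t ->
    expR (2 * u) * expR u ^+ m * F (col_map a b c (expR (2 * u)) (expR u) 0 t) =
    K t * (expR (p * u - s / (2 * x t) * expR (- (2 * u))) * (x t / (expR (- (2 * u)) + eps * x t))).
  move=> xt0; rewrite /F KE// col_diag_map// expR2N; congr (_ * (_ * _)).
  set r := expR _; have r0 : 0 < r by exact: expR_gt0.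
  have rx : 0 < r + eps * x t by rewrite ltr_pwDl// mulr_ge0// ltW.
  by field; rewrite !gt_eqF.
have GE u t : 0 < x t ->
    expR (2 * u) * expR u ^+ m * G (col_map a b c (expR (2 * u)) (expR u) 0 t) =
    K t * (expR (p * u - s / (2 * x t) * expR (- (2 * u))) *
      (2 * (x t * expR (- (2 * u)) / (expR (- (2 * u)) + eps * x t) ^+ 2) +
       p * (x t / (expR (- (2 * u)) + eps * x t)) +
       2 * (s / (2 * x t)) * x t * (expR (- (2 * u)) / (expR (- (2 * u)) + eps * x t)))).
  move=> xt0; rewrite /G KE// col_diag_map// expR2N; congr (_ * (_ * _)).
  set r := expR _; have r0 : 0 < r by exact: expR_gt0.
  have rx : 0 < r + eps * x t by rewrite ltr_pwDl// mulr_ge0// ltW.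
  by field; rewrite !gt_eqF.
have FE0 u t : x t <= 0 -> F (col_map a b c (expR (2 * u)) (expR u) 0 t) = 0.
  by move=> xt0; rewrite /F col_kernel_map0 ?expR_gt0// mul0r mulr0.
have GE0 u t : x t <= 0 -> G (col_map a b c (expR (2 * u)) (expR u) 0 t) = 0.
  by move=> xt0; rewrite /G col_kernel_map0 ?expR_gt0// mul0r mulr0.
split => //; rewrite /Rintegral; clearbody F G K.
suff -> : (\int[leb]_t (G t)%:E = 0)%E by [].
apply: (@integral_flow0 _ _ _ leb (fun u => col_map a b c (expR (2 * u)) (expR u) 0)
  (fun u => expR (2 * u) * expR u ^+ m) F G) => //.
- apply: (@measurable_col_map R n m a b c (fun u => expR (2 * u)) expR (fun=> 0)) => //.
  by apply: (measurableT_comp (@measurable_expR R)).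
- apply: measurable_funM; last exact: measurable_funX.
  by apply: (measurableT_comp (@measurable_expR R)).
- by move=> u g mg g0; apply: ge0_integral_col_map; rewrite ?expR_gt0.
- move=> t u; have [xt0|xt0] := leP (x t) 0.
    rewrite GE0// mulr0 (_ : (fun _ => _) = fun=> 0); first exact: is_derive_cst.
    by apply/funext => v; rewrite FE0// mulr0.
  have := is_deriveZ (K t) (is_derive_scaling p (s / (2 * x t)) u xt0 eps0).
  rewrite GE//; congr is_derive.
  by apply/funext => v; rewrite FE.
- move=> t; have [xt0|xt0] := leP (x t) 0.
    rewrite (_ : (fun _ => _) = fun=> 0); first exact: cst_continuous.
    by apply/funext => v; rewrite GE0// mulr0.
  have cS := @continuous_scaling R (x t) p (s / (2 * x t)) (2 * (s / (2 * x t)) * x t) eps xt0 eps0.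
  set S := (fun _ => _) in cS.
  rewrite (_ : (fun _ => _) = fun v => K t * S v); last first.
    by apply/funext => v; rewrite GE.
  by move=> u; exact: (@cvgMl_tmp _ _ _ _ _ (K t) _ (cS u)).
Qed.

Lemma quad_form_delta (v : 'cV[R]_m) i u :
  quad_form Q (v + u *: delta_mx i 0) =
  quad_form Q v + 2 * u * (Q *m v) i 0 + u ^+ 2 * Q i i.
Proof.
rewrite quad_formD// quad_formZ [(u *: _)^T]linearZ/= -scalemxAl trmx_delta mxE.
rewrite -rowE mxE; congr (_ + _ + u ^+ 2 * _); first by ring.
by rewrite /quad_form trmx_delta -rowE -colE !mxE.
Qed.

(** Integration by parts for F = H x (e + d y_j) along the translations of
    y_i. Here H may depend on x, which leaves room for a cutoff. *)
Lemma integral_translation h i j e d :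
  measurable_fun setT h -> (forall z t, h (col_map a b c 1 1 z t) = h t) ->
  intR (fun t => h t * (k t * (x t * (e + d * y t j 0)))) ->
  intR (fun t => h t * (k t * (d * (j == i)%:R * x t -
    (Q *m y t) i 0 * (e + d * y t j 0)))) ->
  \int[leb]_t (h t * (k t * (d * (j == i)%:R * x t -
    (Q *m y t) i 0 * (e + d * y t j 0)))) = 0.
Proof.
move=> mh hoff intF intG; set F := fun t => _ in intF; set G := fun t => _ in intG *.
pose Phi u t := col_map a b c 1 1 (u *: delta_mx i 0) t.
pose K t := h t * expR (- (alpha / 2 * ln (x t))).
have KE u t A : 0 < x t -> h (Phi u t) * (k (Phi u t) * A) =
    K t * (expR (- ((s + w t) / (2 * x t) + (Q *m y t) i 0 / x t * u +
                     Q i i / (2 * x t) * u ^+ 2)) * A).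
  move=> xt0; rewrite hoff /Phi col_kernel_map// quad_form_delta scale1r ln1 add0r mul1r.
  rewrite expRD /K (_ : - (_ / _) = - ((s + w t) / (2 * x t) +
    (Q *m y t) i 0 / x t * u + Q i i / (2 * x t) * u ^+ 2)); first by ring.
  by field; rewrite gt_eqF.
have yE u t : y (Phi u t) j 0 = y t j 0 + u * (j == i)%:R.
  by rewrite /Phi col_dev_map// scale1r !mxE eqxx andbT.
have QyE u t : (Q *m y (Phi u t)) i 0 = (Q *m y t) i 0 + u * Q i i.
  rewrite /Phi col_dev_map// scale1r mulmxDr [LHS]mxE -scalemxAr -colE.
  by rewrite [X in _ + X = _]mxE [X in _ + u * X = _]mxE.
have xE u t : x (Phi u t) = x t by rewrite /Phi col_diag_map// mul1r.
have FE u t : 0 < x t -> F (Phi u t) = K t * x t *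
    (expR (- ((s + w t) / (2 * x t) + (Q *m y t) i 0 / x t * u +
              Q i i / (2 * x t) * u ^+ 2)) *
     ((e + d * y t j 0) + d * (j == i)%:R * u)).
  by move=> xt0; rewrite /F KE// xE yE; ring.
have GE u t : 0 < x t -> G (Phi u t) = K t * x t *
    (expR (- ((s + w t) / (2 * x t) + (Q *m y t) i 0 / x t * u +
              Q i i / (2 * x t) * u ^+ 2)) *
     (d * (j == i)%:R - ((Q *m y t) i 0 / x t + 2 * (Q i i / (2 * x t)) * u) *
      ((e + d * y t j 0) + d * (j == i)%:R * u))).
  move=> xt0; rewrite /G KE// xE yE QyE -[in RHS]mulrA; congr (_ * _).
  by rewrite [RHS]mulrCA; congr (_ * _); field; rewrite gt_eqF.
have F0 u t : x t <= 0 -> F (Phi u t) = 0.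
  by move=> xt0; rewrite /F col_kernel0 ?xE// mul0r mulr0.
have G0 u t : x t <= 0 -> G (Phi u t) = 0.
  by move=> xt0; rewrite /G col_kernel0 ?xE// mul0r mulr0.
clearbody F G K; rewrite /Rintegral.
suff -> : (\int[leb]_t (G t)%:E = 0)%E by [].
apply: (@integral_flow0 _ _ _ leb Phi (fun=> 1) F G) => //.
- apply: (@measurable_col_map R n m a b c (fun=> 1) (fun=> 1) (fun u => u *: delta_mx i 0)) => // l.
  under eq_fun do rewrite mxE; exact: measurable_funM.
- move=> u g mg g0; rewrite -[RHS](@ge0_integral_col_map _ _ _ a b c b_inj bNa 1 1 (u *: delta_mx i 0))//.
  by rewrite expr1n mulr1.
- move=> t u; rewrite mul1r; under eq_fun do rewrite mul1r.
  have [xt0|xt0] := leP (x t) 0.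
    rewrite G0// (_ : (fun _ => _) = fun=> 0); first exact: is_derive_cst.
    by apply/funext => v; rewrite F0.
  have := is_deriveZ (K t * x t) (is_derive_translation ((s + w t) / (2 * x t))
    ((Q *m y t) i 0 / x t) (Q i i / (2 * x t)) (e + d * y t j 0) (d * (j == i)%:R) u).
  rewrite GE//; congr is_derive.
  by apply/funext => v; rewrite FE.
- move=> t; have [xt0|xt0] := leP (x t) 0.
    rewrite (_ : (fun u : R => 1 * G (Phi u t)) = fun=> 0); first exact: cst_continuous.
    by apply/funext => v; rewrite G0// mulr0.
  have cS := @continuous_translation R ((s + w t) / (2 * x t))
    ((Q *m y t) i 0 / x t) (Q i i / (2 * x t)) (e + d * y t j 0) (d * (j == i)%:R).
  set S := (fun _ => _) in cS.
  rewrite (_ : (fun u : R => 1 * G (Phi u t)) = fun v => K t * x t * S v); last first.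
    by apply/funext => v; rewrite GE// mul1r.
  by move=> u; exact: (@cvgMl_tmp _ _ _ _ _ (K t * x t) _ (cS u)).
Qed.
Hypothesis alpha_gt : m%:R + 4 < alpha.

Let mulQE (v : 'cV[R]_m) i : (Q *m v) i 0 = \sum_l Q i l * v l 0.
Proof. by rewrite mxE. Qed.

Lemma cvg_cutoff (r : R) : 0 < r -> r / (1 + n'.+1%:R^-1 * r) @[n' --> \oo] --> r.
Proof.
move=> r0; rewrite -[X in _ --> X]mulr1; apply: cvgMl_tmp.
rewrite -[X in _ --> X]invr1; apply: cvgV => //.
rewrite -[X in _ --> X]addr0; apply: cvgD; first exact: cvg_cst.
rewrite -(mul0r r); by apply: cvgMr_tmp; exact: cvg_harmonic.
Qed.

Lemma measurable_cutoff (f : n.-tuple R -> R) eps : measurable_fun setT f ->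
  measurable_fun setT (fun t => f t / (1 + eps * x t)).
Proof.
move=> mf; apply: measurable_funM => //; apply: measurable_funV.
by apply: measurable_funD => //; apply: measurable_funM.
Qed.

Lemma integrable_fun_bound (f g : n.-tuple R -> R) C : measurable_fun setT f -> intR g ->
  (forall t, `|f t| <= C * `|g t|) -> intR f.
Proof.
move=> mf ig fg; apply: integrable_fun_le fg => //.
by apply: integrable_funZ; exact: integrable_fun_norm.
Qed.

Lemma cutoff_gt0 (eps r : R) : 0 < eps -> 0 < r -> 0 < 1 + eps * r.
Proof. by move=> eps0 r0; rewrite addr_gt0// mulr_gt0. Qed.

Lemma integrable_cutoff h (eps : R) : 0 < eps -> measurable_fun setT h ->
  intR (fun t => h t * k t) -> intR (fun t => h t * (k t * (x t / (1 + eps * x t)))).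
Proof.
move=> eps0 mh inthk; apply: (integrable_fun_bound (C := eps^-1) _ inthk) => [|t].
  by apply: measurable_funM => //; apply: measurable_funM => //; exact: measurable_cutoff.
have [xt0|xt0] := leP (x t) 0.
  by rewrite col_kernel0// mul0r !mulr0 normr0 mulr0.
rewrite mulrA normrM mulrC ler_wpM2r// ger0_norm; last first.
  by rewrite divr_ge0 ?ltW ?cutoff_gt0.
rewrite ler_pdivrMr ?cutoff_gt0// mulrDr mulr1 mulrA mulVf ?gt_eqF// mul1r.
by rewrite lerDr invr_ge0 ltW.
Qed.

(** In [integral_scaling], x / (1 + eps x)^2 <= x / (1 + eps x) and
    s / (1 + eps x) <= |s|, so the truncated first moment of x is at most
    |s| / (alpha - m - 4) times the mass, whatever eps > 0, because
    alpha > m + 4. *)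
Lemma integrable_col_diag h : measurable_fun setT h -> off_column a b h ->
  intR (fun t => h t * k t) -> intR (fun t => h t * (k t * x t)).
Proof.
move=> mh hoff inthk.
pose g t := `|h t|.
have mg : measurable_fun setT g by exact: (measurableT_comp (@normr_measurable R setT)).
have goff : off_column a b g by move=> t t' tt'; rewrite /g (hoff _ _ tt').
have gk t : g t * k t = `|h t * k t| by rewrite normrM (ger0_norm (col_kernel_ge0 _ _ _ _ _ _ _)).
have intgk : intR (fun t => g t * k t).
  by under eq_fun do rewrite gk; exact: integrable_fun_norm.
suff intgx : intR (fun t => g t * (k t * x t)).
  apply: (integrable_fun_bound (C := 1) _ intgx) => [|t]; last first.
    by rewrite mul1r !normrM normr_id.
  by apply: measurable_funM => //; exact: measurable_funM.
pose eps (i : nat) : R := i.+1%:R^-1.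
have eps0 i : 0 < eps i by rewrite invr_gt0.
pose f_ i t := g t * (k t * (x t / (1 + eps i * x t))).
have int_f i : intR (f_ i) by exact: integrable_cutoff.
have r0 : 0 < alpha - (m%:R + 4) by rewrite subr_gt0.
have g0 t : 0 <= g t by exact: normr_ge0.
have k0 t : 0 <= k t by exact: col_kernel_ge0.
have f_le i : (alpha - (m%:R + 4)) * \int[leb]_t f_ i t <= `|s| * \int[leb]_t (g t * k t).
  have [intG G0] := integral_scaling (ltW (eps0 i)) mg goff intgk (int_f i).
  rewrite -(RintegralZl _ measurableT (int_f i)) -(RintegralZl _ measurableT intgk).
  rewrite -[leRHS]subr0 -[X in _ <= _ - X]G0 -RintegralB//; last exact: integrable_funZ.
  apply: le_Rintegral => //.
  - exact: integrable_funZ.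
  - by apply: integrable_funB => //; exact: integrable_funZ.
  move=> t _; rewrite /f_.
  have [xt0|xt0] := leP (x t) 0.
    by rewrite (col_kernel0 xt0) !(mul0r, mulr0) subr0.
  set q := 1 + eps i * x t.
  have q1 : 1 <= q by rewrite lerDl mulr_ge0// ltW.
  have q0 : 0 < q by exact: lt_le_trans q1.
  have xq : x t / q ^+ 2 <= x t / q.
    rewrite ler_pdivrMr ?exprn_gt0// expr2 mulrA divfK ?gt_eqF//.
    by rewrite ler_peMr// ltW.
  have sq : s / q <= `|s|.
    by rewrite ler_pdivrMr// (le_trans (ler_norm s))// ler_peMr.
  have -> : `|s| * (g t * k t) - g t * (k t * (2 * (x t / q ^+ 2) + p * (x t / q) + s / q)) =
      g t * (k t * (`|s| - (2 * (x t / q ^+ 2) + p * (x t / q) + s / q))) by ring.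
  rewrite [leLHS]mulrCA ler_wpM2l// [leLHS]mulrCA ler_wpM2l//.
  by move: xq sq; set u := x t / q; set v := x t / q ^+ 2; set e := s / q; lra.
apply: (@integrable_fun_limit _ _ _ leb f_ _ (`|s| * \int[leb]_t (g t * k t) / (alpha - (m%:R + 4)))).
- by move=> i; exact: integrable_fun_measurable (int_f i).
- by apply: measurable_funM => //; exact: measurable_funM.
- move=> i t; have [xt0|xt0] := leP (x t) 0.
    by rewrite /f_ (col_kernel0 xt0) !(mul0r, mulr0).
  by rewrite !mulr_ge0 ?invr_ge0 ?(ltW xt0) ?(ltW (cutoff_gt0 (eps0 i) xt0)).
- move=> t i j ij; have [xt0|xt0] := leP (x t) 0.
    by rewrite /f_ (col_kernel0 xt0) !(mul0r, mulr0).
  rewrite !ler_wpM2l ?(ltW xt0)// lef_pV2 ?posrE ?cutoff_gt0// lerD2l ler_wpM2r ?(ltW xt0)//.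
  by rewrite /eps lef_pV2 ?posrE ?ltr0n// ler_nat ltnS.
- move=> t; have [xt0|xt0] := leP (x t) 0.
    under eq_fun do rewrite /f_ (col_kernel0 xt0) mul0r mulr0.
    by rewrite (col_kernel0 xt0) mul0r mulr0; exact: cvg_cst.
  by apply: cvgMl_tmp; apply: cvgMl_tmp; exact: cvg_cutoff.
- move=> i; rewrite -[leLHS]fineK; last exact/integrable_fin_num/int_f.
  by rewrite lee_fin ler_pdivlMr// mulrC; exact: f_le.
Qed.

Lemma integral_col_diag h : measurable_fun setT h -> off_column a b h ->
  intR (fun t => h t * k t) ->
  (alpha - m%:R - 4) * \int[leb]_t (h t * (k t * x t)) = s * \int[leb]_t (h t * k t).
Proof.
move=> mh hoff inthk; have intx := integrable_col_diag mh hoff inthk.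
have intx0 : intR (fun t => h t * (k t * (x t / (1 + 0 * x t)))).
  by under eq_fun do rewrite mul0r addr0 divr1.
have [_] := integral_scaling (lexx 0) mh hoff inthk intx0.
rewrite (@eq_Rintegral _ _ _ _ _
  (fun t => s * (h t * k t) - (alpha - m%:R - 4) * (h t * (k t * x t)))); last first.
  by move=> t _; rewrite mul0r addr0 expr1n !divr1; ring.
rewrite RintegralB//; [|exact: integrable_funZ..].
by rewrite !RintegralZl// => /eqP; rewrite subr_eq0 => /eqP ->.
Qed.

(** Since 3 w / (8 x) <= exp(3 w / (8 x)), the function w exp(- w / (2 x)) is
    at most 8/3 x exp(- w / (8 x)), which is x times the kernel up to the dilation
    y |-> y / 2. *)
Lemma integrable_quad_form h : measurable_fun setT h -> off_column a b h ->
  intR (fun t => h t * k t) -> intR (fun t => h t * (k t * w t)).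
Proof.
move=> mh hoff inthk.
have intx := integrable_col_diag mh hoff inthk.
have h2 : 0 < 2^-1 :> R by rewrite invr_gt0.
have J0 : 0 < 1 * 2^-1 ^+ m :> R by rewrite mul1r exprn_gt0.
have mPhi : measurable_fun setT (col_map a b c 1 2^-1 0) by exact: measurable_affine_tuple.
have [intf _] := integral_change_variable (ltW J0) mPhi
  (fun g mg g0 => ge0_integral_col_map c b_inj bNa 0 ltr01 h2 mg g0) intx.
apply: (integrable_fun_bound (C := 8 / 3 / (1 * 2^-1 ^+ m)) _ intf) => [|t].
  by apply: measurable_funM => //; exact: measurable_funM.
rewrite [X in _ <= _ * X]normrM (gtr0_norm J0) [leRHS]mulrA divfK ?gt_eqF// off_column_map// col_diag_map// mul1r.
rewrite !normrM [leRHS]mulrCA ler_wpM2l//.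
have [xt0|xt0] := leP (x t) 0.
  by rewrite (col_kernel0 xt0) normr0 mul0r !mulr_ge0.
rewrite col_kernel_map// ln1 add0r mul1r addr0 quad_formZ /col_kernel xt0.
rewrite !ger0_norm ?expR_ge0 ?(ltW xt0) ?quad_form_ge0//.
set W := w t; have W0 : 0 <= W by exact: quad_form_ge0.
have -> : - ((s + 2^-1 ^+ 2 * W) / (2 * x t)) - alpha / 2 * ln (x t) =
  (- ((s + W) / (2 * x t)) - alpha / 2 * ln (x t)) + 3 * W / (8 * x t).
  by field; rewrite gt_eqF.
rewrite (expRD _ (3 * W / (8 * x t))); have := expR_ge1Dx (3 * W / (8 * x t)).
set e := expR _; set K := expR _ => e_ge.
have -> : 8 / 3 * (K * e * x t) = K * (8 / 3 * e * x t) by ring.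
rewrite ler_wpM2l ?expR_ge0//.
have -> : W = 8 / 3 * (3 * W / (8 * x t)) * x t by field; rewrite gt_eqF.
rewrite ler_wpM2r ?(ltW xt0)// ler_wpM2l// (le_trans _ e_ge)//.
by rewrite lerDr.
Qed.

Lemma integrable_colM h i j : measurable_fun setT h -> off_column a b h ->
  intR (fun t => h t * k t) -> intR (fun t => h t * (k t * (y t i 0 * y t j 0))).
Proof.
move=> mh hoff inthk.
have intw := integrable_quad_form mh hoff inthk.
apply: (integrable_fun_bound (C := invmx Q i i + invmx Q j j) _ intw) => [|t].
  by apply: measurable_funM => //; apply: measurable_funM => //; exact: measurable_funM.
rewrite !normrM [leRHS]mulrCA ler_wpM2l// [leRHS]mulrCA ler_wpM2l// (ger0_norm (quad_form_ge0 Q_posdef _)).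
rewrite mulrDl (le_trans _ (lerD (quad_form_ge_coord Q_posdef (y t) i)
  (quad_form_ge_coord Q_posdef (y t) j)))//.
rewrite -[y t i 0 ^+ 2]real_normK ?num_real// -[y t j 0 ^+ 2]real_normK ?num_real//.
set u := `|_|; set v := `|_|; have u0 : 0 <= u by exact: normr_ge0.
have v0 : 0 <= v by exact: normr_ge0.
nra.
Qed.

(** From |v| <= 1 + v^2. *)
Lemma integrable_col h j : measurable_fun setT h -> off_column a b h ->
  intR (fun t => h t * k t) -> intR (fun t => h t * (k t * y t j 0)).
Proof.
move=> mh hoff inthk.
have inty := integrable_colM j j mh hoff inthk.
apply: (@integrable_fun_le _ _ _ leb _ (fun t => `|h t * k t| +
  `|h t * (k t * (y t j 0 * y t j 0))|)) => [||t].
- by apply: measurable_funM => //; exact: measurable_funM.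
- by apply: integrable_funD; exact: integrable_fun_norm.
rewrite !normrM mulrA [X in _ + X]mulrA -[X in X + _]mulr1 -mulrDr ler_wpM2l ?mulr_ge0//.
set u := `|_|; have u0 : 0 <= u by exact: normr_ge0.
nra.
Qed.

Lemma integrable_colMQ h i j : measurable_fun setT h -> off_column a b h ->
  intR (fun t => h t * k t) -> intR (fun t => h t * (k t * (y t j 0 * (Q *m y t) i 0))).
Proof.
move=> mh hoff inthk.
rewrite (_ : (fun _ => _) = fun t => \sum_l Q i l * (h t * (k t * (y t j 0 * y t l 0)))).
  apply: integrable_fun_sum => l; apply: integrable_funZ; exact: integrable_colM.
apply/funext => t; rewrite mulQE !big_distrr/=; apply: eq_bigr => l _; ring.
Qed.

(** The translations give E(H (Q y)_i) = 0 for all i; now apply Q^-1. *)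
Lemma integral_col h j : measurable_fun setT h -> off_column a b h ->
  intR (fun t => h t * k t) -> \int[leb]_t (h t * (k t * y t j 0)) = 0.
Proof.
move=> mh hoff inthk.
have intx := integrable_col_diag mh hoff inthk.
have intQ i : intR (fun t => h t * (k t * (Q *m y t) i 0)).
  rewrite (_ : (fun _ => _) = fun t => \sum_l Q i l * (h t * (k t * y t l 0))).
    apply: integrable_fun_sum => l; apply: integrable_funZ; exact: integrable_col.
  by apply/funext => t; rewrite mulQE !big_distrr/=; apply: eq_bigr => l _; ring.
have Q0 i : \int[leb]_t (h t * (k t * (Q *m y t) i 0)) = 0.
  have E t : h t * (k t * (0 * (j == i)%:R * x t - (Q *m y t) i 0 * (1 + 0 * y t j 0))) =
      - 1 * (h t * (k t * (Q *m y t) i 0)) by ring.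
  have intF : intR (fun t => h t * (k t * (x t * (1 + 0 * y t j 0)))).
    rewrite (_ : (fun _ => _) = fun t => h t * (k t * x t)) => //.
    by apply/funext => t; ring.
  have intG : intR (fun t =>
      h t * (k t * (0 * (j == i)%:R * x t - (Q *m y t) i 0 * (1 + 0 * y t j 0)))).
    rewrite (_ : (fun _ => _) = fun t => - 1 * (h t * (k t * (Q *m y t) i 0))).
      exact: integrable_funZ.
    by apply/funext => t; exact: E.
  have := integral_translation mh
    (fun z t => off_column_map c 1 1 z t hoff) intF intG.
  rewrite (@eq_Rintegral _ _ _ _ _ (fun t => - 1 * (h t * (k t * (Q *m y t) i 0)))); last first.
    by move=> t _; exact: E.
  by rewrite (RintegralZl _ measurableT (intQ i)) mulN1r => /eqP; rewrite oppr_eq0 => /eqP.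
have yE t : y t j 0 = \sum_i invmx Q j i * (Q *m y t) i 0.
  by rewrite -[in LHS](mulKmx (posdefmx_unit Q_posdef) (y t)) mxE.
under eq_Rintegral do rewrite yE 2!big_distrr/=.
rewrite Rintegral_sum => [|i].
  apply: big1 => i _.
  rewrite (@eq_Rintegral _ _ _ _ _ (fun t => invmx Q j i * (h t * (k t * (Q *m y t) i 0)))).
    by rewrite (RintegralZl _ measurableT (intQ i)) Q0 mulr0.
  by move=> t _; ring.
rewrite (_ : (fun _ => _) = fun t => invmx Q j i * (h t * (k t * (Q *m y t) i 0))).
  exact: integrable_funZ.
by apply/funext => t; ring.
Qed.

(** The function H x y_j need not be integrable, as it behaves like x^(3/2)
    while only first moments of x are available. So the translation identity is
    applied to H x y_j / (1 + eps x), and eps tends to 0 by dominated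
    convergence. *)
Lemma integral_colMQ h i j : measurable_fun setT h -> off_column a b h ->
  intR (fun t => h t * k t) ->
  \int[leb]_t (h t * (k t * (y t j 0 * (Q *m y t) i 0))) =
  (j == i)%:R * \int[leb]_t (h t * (k t * x t)).
Proof.
move=> mh hoff inthk.
have intx := integrable_col_diag mh hoff inthk.
have inty := integrable_col j mh hoff inthk.
have intQ := integrable_colMQ i j mh hoff inthk.
pose eps (N : nat) : R := N.+1%:R^-1.
have eps0 N : 0 < eps N by rewrite invr_gt0.
(* the cutoff is absorbed in the function H, which may depend on x *)
pose h_ N t := h t / (1 + eps N * x t).
pose A t := k t * (1 * (j == i)%:R * x t - (Q *m y t) i 0 * (0 + 1 * y t j 0)).
have mA : measurable_fun setT A.
  apply: measurable_funM => //; apply: measurable_funB; apply: measurable_funM => //.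
  by apply: measurable_funD => //; apply: measurable_funM.
have mh_ N : measurable_fun setT (h_ N) by exact: measurable_cutoff.
have hA t : h t * A t = (j == i)%:R * (h t * (k t * x t)) -
    h t * (k t * (y t j 0 * (Q *m y t) i 0)) by rewrite /A; ring.
have inthA : intR (fun t => h t * A t).
  under eq_fun do rewrite hA.
  by apply: integrable_funB => //; exact: integrable_funZ.
have A0 t : x t <= 0 -> A t = 0 by move=> xt0; rewrite /A col_kernel0// mul0r.
have le_hA N t : `|h_ N t * A t| <= `|h t * A t|.
  have [xt0|xt0] := leP (x t) 0; first by rewrite A0// !mulr0 normr0.
  have den1 : 1 <= 1 + eps N * x t by rewrite lerDl mulr_ge0// ltW.
  have den0 : 0 < 1 + eps N * x t by exact: lt_le_trans den1.
  rewrite !normrM ler_wpM2r// (gtr0_norm (x := (1 + _)^-1)) ?invr_gt0//.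
  by rewrite ler_pdivrMr// ler_peMr.
have int_hA N : intR (fun t => h_ N t * A t).
  apply: (integrable_fun_bound (C := 1) _ inthA) => [|t]; last by rewrite mul1r.
  exact: measurable_funM.
have int_hxy N : intR (fun t => h_ N t * (k t * (x t * (0 + 1 * y t j 0)))).
  apply: (integrable_fun_bound (C := (eps N)^-1) _ inty) => [|t].
    apply: measurable_funM => //; apply: measurable_funM => //; apply: measurable_funM => //.
    by apply: measurable_funD => //; apply: measurable_funM.
  have [xt0|xt0] := leP (x t) 0; first by rewrite col_kernel0// !mul0r !mulr0 normr0 mulr0.
  have den0 : 0 < 1 + eps N * x t by exact: cutoff_gt0.
  have -> : h_ N t * (k t * (x t * (0 + 1 * y t j 0))) =
    (x t / (1 + eps N * x t)) * (h t * (k t * y t j 0)) by rewrite /h_; ring.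
  rewrite normrM ler_wpM2r// ger0_norm ?divr_ge0 ?(ltW xt0) ?(ltW den0)//.
  rewrite ler_pdivrMr// mulrDr mulr1 mulrA mulVf ?gt_eqF// mul1r.
  by rewrite lerDr invr_ge0 ltW.
have hA0 N : \int[leb]_t (h_ N t * A t) = 0.
  apply: integral_translation => // z t.
  by rewrite /h_ col_diag_map// mul1r (off_column_map _ _ _ _ _ hoff).
have cvgh t : h_ N t * A t @[N --> \oo] --> h t * A t.
  have [xt0|xt0] := leP (x t) 0.
    by under eq_fun do rewrite A0// mulr0; rewrite A0// mulr0; exact: cvg_cst.
  apply: cvgMr_tmp; rewrite -[X in _ --> X](mulfK (x := x t)) ?gt_eqF//.
  under eq_fun do rewrite -[h_ _ _](mulfK (x := x t)) ?gt_eqF//.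
  apply: cvgMr_tmp; under eq_fun do rewrite /h_ mulrAC -mulrA.
  by apply: cvgMl_tmp; exact: cvg_cutoff.
have cvgI : (\int[leb]_t (h_ N t * A t)%:E @[N --> \oo] --> \int[leb]_t (h t * A t)%:E)%E.
  have [] // := @dominated_convergence _ _ _ leb setT measurableT
    (fun N t => (h_ N t * A t)%:E) (fun t => (h t * A t)%:E) (fun t => `|h t * A t|%:E).
  - by move=> N; exact: measurable_int (int_hA N).
  - exact: measurable_int inthA.
  - by apply: aeW => t _; apply: cvg_EFin; [exact: nearW|exact: cvgh].
  - exact: integrable_fun_norm inthA.
  - by apply: aeW => t N _; exact: le_hA.
have I0 : (fun N => \int[leb]_t (h_ N t * A t)%:E)%E = fun=> 0%E.
  apply/funext => N; rewrite -[LHS]fineK; last exact/integrable_fin_num/int_hA.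
  by rewrite -[fine _]/(Rintegral _ _ _) hA0.
have {I0 cvgI} : \int[leb]_t (h t * A t) = 0.
  by move: cvgI; rewrite I0 /Rintegral => /cvg_lim <- //; rewrite lim_cst.
under eq_Rintegral do rewrite hA.
rewrite RintegralB//; last exact: integrable_funZ.
by rewrite (RintegralZl _ measurableT intx) => /eqP; rewrite subr_eq0 => /eqP ->.
Qed.

(** Apply Q^-1 to [integral_colMQ]. *)
Lemma integral_colM h i j : measurable_fun setT h -> off_column a b h ->
  intR (fun t => h t * k t) ->
  \int[leb]_t (h t * (k t * (y t i 0 * y t j 0))) =
  invmx Q i j * \int[leb]_t (h t * (k t * x t)).
Proof.
move=> mh hoff inthk.
have intQ l := integrable_colMQ l j mh hoff inthk.
have yE t : y t i 0 = \sum_l invmx Q i l * (Q *m y t) l 0.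
  by rewrite -[in LHS](mulKmx (posdefmx_unit Q_posdef) (y t)) mxE.
have E l t : h t * (k t * (invmx Q i l * (Q *m y t) l 0 * y t j 0)) =
  invmx Q i l * (h t * (k t * (y t j 0 * (Q *m y t) l 0))) by ring.
under eq_Rintegral do rewrite yE big_distrl/= 2!big_distrr/=.
rewrite Rintegral_sum => [|l]; last first.
  rewrite (_ : (fun _ => _) = fun t =>
    invmx Q i l * (h t * (k t * (y t j 0 * (Q *m y t) l 0)))); last exact/funext/E.
  exact: integrable_funZ.
have TE l : \int[leb]_t (h t * (k t * (invmx Q i l * (Q *m y t) l 0 * y t j 0))) =
    invmx Q i l * ((j == l)%:R * \int[leb]_t (h t * (k t * x t))).
  under eq_Rintegral do rewrite E.
  by rewrite (RintegralZl _ measurableT (intQ l)) integral_colMQ.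
under eq_bigr do rewrite TE.
rewrite (bigD1 j)//= big1 ?addr0 ?eqxx ?mul1r// => l lj.
by rewrite eq_sym (negbTE lj) mul0r mulr0.
Qed.

End moments.

(** * Expectations of a random variable with a density *)

Section density.
Context {R : realType} d (T : measurableType d).
Variables (mu nu : {measure set T -> \bar R}) (g : T -> R).
Hypotheses (mg : measurable_fun setT g) (g0 : forall t, 0 <= g t).
Hypothesis nuE : forall A, measurable A -> nu A = (\int[mu]_(t in A) (g t)%:E)%E.
Local Open Scope ereal_scope.

Import HBNNSimple.

Let ge0_integral_density_nnsfun (f : {nnsfun T >-> R}) :
  \int[nu]_t (f t)%:E = \int[mu]_t ((f t)%:E * (g t)%:E).
Proof.
have fE t : (f t)%:E = \sum_(k \in range f) k%:E * (\1_(f @^-1` [set k]) t)%:E.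
  by rewrite fsumEFin //= fimfunE.
have mind k : measurable_fun setT (fun t => (\1_(f @^-1` [set k]) t)%:E : \bar R).
  exact/measurable_EFinP.
have mindg k : measurable_fun setT
    (fun t => (\1_(f @^-1` [set k]) t)%:E * (g t)%:E : \bar R).
  by apply: emeasurable_funM => //; exact/measurable_EFinP.
under [LHS]eq_integral do rewrite fE.
rewrite ge0_integral_fsum//; last 2 first.
  - by move=> r; exact: measurable_funeM.
  - by move=> r /= z _; exact: nnfun_muleindic_ge0.
have fgE t : (f t)%:E * (g t)%:E =
    \sum_(k \in range f) k%:E * ((\1_(f @^-1` [set k]) t)%:E * (g t)%:E).
  rewrite fE ge0_mule_fsuml; last by move=> r; exact: nnfun_muleindic_ge0.
  by apply: eq_fsbigr => k _; rewrite muleA.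
under [RHS]eq_integral do rewrite fgE.
rewrite ge0_integral_fsum//; last 2 first.
  - by move=> r; exact: measurable_funeM.
  - by move=> r /= z _; rewrite muleA mule_ge0 ?lee_fin//; exact: nnfun_muleindic_ge0.
apply: eq_fsbigr => k; rewrite inE => -[t0 _ <-{k}].
rewrite !ge0_integralZl ?lee_fin//; last by move=> t _; rewrite mule_ge0 ?lee_fin.
congr (_ * _); rewrite integral_indic// setIT nuE//.
rewrite integral_mkcond; apply: eq_integral => t _.
rewrite patchE indicE; case: ifP => _; first by rewrite mul1e.
by rewrite mul0e.
Qed.

(** Both sides agree on simple functions by assumption, and monotone
    convergence extends this to all nonnegative functions. *)
Lemma ge0_integral_density (f : T -> \bar R) : measurable_fun setT f ->
  (forall t, 0 <= f t) -> \int[nu]_t f t = \int[mu]_t (f t * (g t)%:E).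
Proof.
move=> mf f0; pose f_ := nnsfun_approx measurableT mf.
have f_cvg t : (f_ n t)%:E @[n --> \oo] --> f t by exact: cvg_nnsfun_approx.
have f_nd t : {homo (fun n => (f_ n t)%:E) : n m / (n <= m)%N >-> n <= m}.
  by move=> n m nm; rewrite lee_fin; exact/lefP/nd_nnsfun_approx.
have cvg_nu : \int[nu]_t (f_ n t)%:E @[n --> \oo] --> \int[nu]_t f t.
  rewrite (eq_integral (fun t => limn (fun n => (f_ n t)%:E))); last first.
    by move=> t _; apply/esym/cvg_lim.
  apply: (cvg_monotone_convergence measurableT) => [n|n t _|t _ n m nm].
  - exact/measurable_EFinP.
  - by rewrite lee_fin.
  - exact: f_nd.
have cvg_mu : \int[mu]_t ((f_ n t)%:E * (g t)%:E) @[n --> \oo] -->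
    \int[mu]_t (f t * (g t)%:E).
  rewrite (eq_integral (fun t => limn (fun n => (f_ n t)%:E * (g t)%:E))); last first.
    by move=> t _; apply/esym/cvg_lim => //; exact: cvgeZr.
  apply: (cvg_monotone_convergence measurableT) => [n|n t _|t _ n m nm].
  - by apply: emeasurable_funM; exact/measurable_EFinP.
  - by rewrite mule_ge0 ?lee_fin.
  - by rewrite lee_wpmul2r ?lee_fin//; exact: f_nd.
rewrite -(cvg_lim _ cvg_nu)// -(cvg_lim _ cvg_mu)//.
by under eq_fun do rewrite ge0_integral_density_nnsfun.
Qed.

Lemma integral_density (f : T -> R) : measurable_fun setT f ->
  integrable_fun mu (fun t => f t * g t)%R ->
  nu.-integrable setT (EFin \o f) /\
  \int[nu]_t (f t)%:E = \int[mu]_t (f t * g t)%:E.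
Proof.
move=> mf /integrableP[mfg fgoo].
have E (F : \bar R -> \bar R) : measurable_fun setT F -> (forall x, 0 <= F x) ->
    (forall x (r : R), (0 <= r)%R -> F (x * r%:E) = F x * r%:E) ->
    \int[nu]_t F (f t)%:E = \int[mu]_t F (f t * g t)%:E.
  move=> mF F0 FM; rewrite (@ge0_integral_density (fun t => F (f t)%:E))//; last first.
    by apply: measurableT_comp => //; exact/measurable_EFinP.
  by apply: eq_integral => t _; rewrite EFinM FM.
split.
  apply: integrable_funP => //.
  rewrite [X in X < _](_ : _ = \int[mu]_t `|(f t * g t)%:E|)//.
  by apply: (E abse) => // x r r0; rewrite abseM (gee0_abs (x := r%:E)).
rewrite [LHS]integralE [RHS]integralE; congr (_ - _).
- transitivity (\int[nu]_t maxe (f t)%:E 0).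
    by apply: eq_integral => t _; rewrite funeposE.
  transitivity (\int[mu]_t maxe (f t * g t)%:E 0); last first.
    by apply: eq_integral => t _; rewrite funeposE.
  apply: (E (fun x => maxe x 0)) => [|x|x r r0]; first exact: measurable_maxe.
    by rewrite le_max lexx orbT.
  by rewrite maxe_pMl// mul0e.
- transitivity (\int[nu]_t maxe (- (f t)%:E) 0).
    by apply: eq_integral => t _; rewrite funenegE.
  transitivity (\int[mu]_t maxe (- (f t * g t)%:E) 0); last first.
    by apply: eq_integral => t _; rewrite funenegE.
  apply: (E (fun x => maxe (- x) 0)) => [|x|x r r0].
  + by apply: measurable_maxe => //; exact: oppe_measurable.
  + by rewrite le_max lexx orbT.
  + by rewrite -mulNe maxe_pMl// mul0e.
Qed.

End density.

Section random_density.
Context {R : realType} d d' (S : measurableType d) (T : measurableType d').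
Variables (P : {measure set S -> \bar R}) (mu : {measure set T -> \bar R}).
Variables (X : S -> T) (g : T -> R).
Hypotheses (mX : measurable_fun setT X).
Hypotheses (mg : measurable_fun setT g) (g0 : forall t, 0 <= g t).
Hypothesis XE : forall A, measurable A -> P (X @^-1` A) = (\int[mu]_(t in A) (g t)%:E)%E.

Lemma integral_random_density (f : T -> R) : measurable_fun setT f ->
  integrable_fun mu (fun t => f t * g t) ->
  P.-integrable setT (fun w => (f (X w))%:E) /\
  (\int[P]_w (f (X w))%:E = \int[mu]_t (f t * g t)%:E)%E.
Proof.
move=> mf intfg.
pose nu : {measure set T -> \bar R} :=
  measure_function_pushforward__canonical__measure_function_Measure P mX.
have [intf intE] := @integral_density _ _ _ mu nu g mg g0 XE f mf intfg.
have intX : P.-integrable setT (fun w => (f (X w))%:E).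
  apply/integrableP; split; first exact/measurable_EFinP/(measurableT_comp mf mX).
  have /integrableP[_] := intf.
  rewrite ge0_integral_pushforward//.
  by apply: measurableT_comp => //; exact/measurable_EFinP.
split => //; rewrite -intE (integral_pushforward mX _ intX)//.
exact/measurable_EFinP.
Qed.

End random_density.

(** * Recursive computation of L^-T D L^-1 *)

Section cholesky_recursion.
Context {R : realType} {p : nat} (E : {set 'I_p * 'I_p}).
Hypothesis E_parent : parent_ordering E.

Lemma pa_gt i k : k \in pa E i -> (i < k)%N.
Proof. by rewrite inE => /andP[ki kiE]; exact: E_parent kiE. Qed.

Lemma pa_edge i k : k \in pa E i -> (k, i) \in E.
Proof. by rewrite inE => /andP[]. Qed.

(** Descent on the pair (i, j): an entry is reduced to entries whose smaller
    index is larger, since parents come after their children. *)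
Lemma parent_ind (P : 'I_p -> 'I_p -> Prop) :
  (forall i j, P i j -> P j i) ->
  (forall i j : 'I_p, (i < j)%N -> (forall k, k \in pa E i -> P j k) -> P j i) ->
  (forall i, (forall k l, k \in pa E i -> l \in pa E i -> P k l) -> P i i) ->
  forall i j, P i j.
Proof.
move=> Psym Poff Pdiag.
suff PN N (i j : 'I_p) : (p - N <= i)%N -> (p - N <= j)%N -> P i j.
  by move=> i j; apply: (PN p); rewrite subnn.
elim: N i j => [|N IH] i j.
  by rewrite subn0 leqNgt ltn_ord.
have Plt : forall k l : 'I_p, (p - N.+1 <= k)%N -> (k < l)%N -> P l k.
  move=> k l Nk kl; apply: Poff => // u /pa_gt ku.
  by apply: IH; rewrite leq_subLR; rewrite leq_subLR in Nk; lia.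
move=> Ni Nj; have [ij|ji|/val_inj <-] := ltngtP i j.
- by apply: Psym; exact: Plt.
- exact: Plt.
apply: Pdiag => k l /pa_gt ik /pa_gt il.
by apply: IH; rewrite leq_subLR; rewrite leq_subLR in Ni; lia.
Qed.

Lemma invmx_unitrig (L : 'M[R]_p) : is_trig_mx L -> (forall i, L i i = 1) ->
  L \in unitmx /\ forall i j : 'I_p, (i <= j)%N -> invmx L i j = (i == j)%:R.
Proof.
move=> /is_trig_mxP Ltrig L1.
have LU : L \in unitmx.
  rewrite unitmxE (_ : \det L = 1) ?unitr1//.
  by rewrite (det_trig (introT is_trig_mxP Ltrig)) big1.
split => //.
suff ltN N (i j : 'I_p) : (i < N)%N -> (i <= j)%N -> invmx L i j = (i == j)%:R.
  by move=> i j; exact: (ltN i.+1).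
elim: N i j => // N IH i j iN ij.
have := mulmxV LU => /matrixP/(_ i j); rewrite !mxE (bigD1 i)//= L1 mul1r.
rewrite big1 ?addr0// => k ki; have [ik|ki'|/val_inj ik] := ltngtP i k.
- by rewrite Ltrig// mul0r.
- rewrite (IH k j)//; [|lia|lia].
  by case: eqVneq => [kj|_]; [move: ij; rewrite -kj leqNgt ki'|rewrite mulr0].
- by rewrite ik eqxx in ki.
Qed.

(** Compare the entries (j, i) of S L = L^-T D, where L^-T is upper triangular
    with unit diagonal: the right-hand side is zero below the diagonal and D_ii on
    it. *)
Lemma cholesky_recursion (D L : 'M[R]_p) (i j : 'I_p) : is_diag_mx D -> cholesky_space E L ->
  (i <= j)%N ->
  let S := (invmx L)^T *m D *m invmx L in
  S j i = (i == j)%:R * D i i - \sum_(k in pa E i) S j k * L k i.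
Proof.
move=> /is_diag_mxP Ddiag [Ltrig L1 L0] ij S.
have [LU Linv] := invmx_unitrig Ltrig L1.
have := mulmxKV LU ((invmx L)^T *m D); rewrite -/S => /matrixP/(_ j i).
rewrite [RHS]mxE (bigD1 i)//= [X in _ = _ + X]big1 => [|k ki]; last by rewrite Ddiag// mulr0.
rewrite [in RHS]mxE Linv// addr0 => <-.
rewrite [(S *m L) j i]mxE (bigD1 i)//= L1 mulr1 [X in _ = _ + X - _](bigID (mem (pa E i)))/=.
rewrite [X in _ + (_ + X)]big1 => [|k /andP[ki kpa]]; last by rewrite L0// mulr0.
rewrite addr0 (eq_bigl (mem (pa E i))) ?addrK// => k /=.
by rewrite andb_idl// inE => /andP[].
Qed.

Lemma cholesky_sym (D L : 'M[R]_p) i j : is_diag_mx D ->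
  let S := (invmx L)^T *m D *m invmx L in S i j = S j i.
Proof.
move=> Ddiag S; suff {1}<- : S^T = S by rewrite mxE.
have DT : D^T = D.
  apply/matrixP => k l; rewrite mxE; have [->//|kl] := eqVneq k l.
  by have /is_diag_mxP D0 := Ddiag; rewrite !D0// eq_sym.
by rewrite /S !trmx_mul trmxK DT mulmxA.
Qed.

End cholesky_recursion.

(** * Coordinates indexed by the edges *)

Section coordinates.
Context {R : realType} {p : nat} (E : {set 'I_p * 'I_p}).
Hypotheses (E_dag : dag E) (E_parent : parent_ordering E).
Implicit Types (t : #|E|.-tuple R).

(** The positions in a coordinate tuple of the parameters D_ii and L_ki. *)
Definition loop_index i : 'I_#|E| := enum_rank_in (E_dag.1 i) (i, i).
Definition parent_index i (k : 'I_#|pa E i|) : 'I_#|E| :=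
  enum_rank_in (E_dag.1 i) (enum_val k, i).

Lemma edge_coord_rank t e0 (E0 : e0 \in E) e : e \in E ->
  edge_coord t e = tnth t (enum_rank_in E0 e).
Proof.
move=> eE; rewrite /edge_coord (tnth_nth 0); congr nth.
rewrite -{1}(enum_rankK_in E0 eE) (enum_val_nth e) index_uniq ?enum_uniq//.
by rewrite -cardE.
Qed.

Lemma edge_coord_loop t i : edge_coord t (i, i) = tnth t (loop_index i).
Proof. by rewrite (edge_coord_rank _ (E_dag.1 i))// E_dag.1. Qed.

Lemma edge_coord_parent t i (k : 'I_#|pa E i|) :
  edge_coord t (enum_val k, i) = tnth t (parent_index k).
Proof. by rewrite (edge_coord_rank _ (E_dag.1 i))// pa_edge// enum_valP. Qed.

Lemma enum_val_neq i (k : 'I_#|pa E i|) : enum_val k != i.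
Proof. by have := enum_valP k; rewrite inE => /andP[]. Qed.

Lemma parent_index_inj i : injective (@parent_index i).
Proof.
move=> k l /(congr1 enum_val); rewrite !enum_rankK_in ?pa_edge ?enum_valP//.
by case=> /enum_val_inj.
Qed.

Lemma parent_index_neq i (k : 'I_#|pa E i|) : parent_index k != loop_index i.
Proof.
apply/eqP => /(congr1 enum_val); rewrite !enum_rankK_in ?E_dag.1 ?pa_edge ?enum_valP//.
by case=> /eqP; rewrite (negbTE (enum_val_neq k)).
Qed.

Lemma L_of_coord_cholesky t : cholesky_space E (L_of_coord t).
Proof.
have L0 i j : i != j -> (i, j) \notin E -> L_of_coord t i j = 0.
  move=> ij ijE; rewrite mxE (negbTE ij) /edge_coord nth_default// size_tuple cardE.
  by rewrite memNindex// mem_enum.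
split.
- apply/is_trig_mxP => i j ij; apply: L0; first by rewrite -val_eqE/= ltn_eqF.
  apply/negP => ijE; have := @E_parent i j; rewrite -val_eqE/= ltn_eqF// => /(_ isT ijE).
  by rewrite ltnNge ltnW.
- by move=> i; rewrite mxE eqxx.
- by move=> i j ij; rewrite inE ij/=; exact: L0.
Qed.

Lemma D_of_coord_diag t : is_diag_mx (D_of_coord t).
Proof. exact: diag_mx_is_diag. Qed.

Lemma D_of_coordE t i : D_of_coord t i i = tnth t (loop_index i).
Proof. by rewrite !mxE eqxx edge_coord_loop. Qed.

Lemma L_of_coordE t i (k : 'I_#|pa E i|) :
  L_of_coord t (enum_val k) i = tnth t (parent_index k).
Proof. by rewrite mxE (negbTE (enum_val_neq k)) edge_coord_parent. Qed.

Lemma Theta_of_coord t :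
  Theta E (D_of_coord t) (L_of_coord t) <-> forall i, 0 < tnth t (loop_index i).
Proof.
split=> [[_ D0 _] i|x0]; first by rewrite -D_of_coordE.
split; [exact: D_of_coord_diag| |exact: L_of_coord_cholesky].
by move=> i; rewrite D_of_coordE.
Qed.

Lemma edge_coord_Theta (D L : 'M[R]_p) e : e \in E ->
  edge_coord (Theta_coord E D L) e = if e.1 == e.2 then D e.1 e.1 else L e.1 e.2.
Proof.
move=> eE; rewrite /edge_coord /= (nth_map e) ?nth_index ?mem_enum//.
by rewrite index_mem mem_enum.
Qed.

Lemma Theta_coordK (D L : 'M[R]_p) : Theta E D L ->
  D_of_coord (Theta_coord E D L) = D /\ L_of_coord (Theta_coord E D L) = L.
Proof.
move=> [/is_diag_mxP Ddiag _ [_ L1 L0]]; split; apply/matrixP => i j.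
  rewrite !mxE; case: eqVneq => [->|ij]; last by rewrite mulr0n Ddiag.
  by rewrite edge_coord_Theta ?E_dag.1// eqxx.
rewrite mxE; have [->|ij] := eqVneq i j; first by rewrite L1.
have [ijE|ijE] := boolP ((i, j) \in E).
  by rewrite edge_coord_Theta//= (negbTE ij).
rewrite L0//; last by rewrite inE ij.
have [_ _ /(_ i j ij)] := L_of_coord_cholesky (Theta_coord E D L).
by rewrite inE ij /= => /(_ ijE); rewrite mxE (negbTE ij).
Qed.

End coordinates.

(** * Factorization of the DAG-Wishart density over the columns *)

Section column_factorization.
Context {R : realType} {p : nat} (E : {set 'I_p * 'I_p}) (U : 'M[R]_p).
Hypothesis U_posdef : posdefmx U.

Let sel i : 'M[R]_(p, #|pa E i|) := colsub enum_val 1%:M.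

Let selT i : (sel i)^T = rowsub enum_val 1%:M.
Proof. by apply/matrixP => k l; rewrite !mxE eq_sym. Qed.

Lemma mx_paE i : mx_pa E U i = (sel i)^T *m U *m sel i.
Proof. by rewrite selT mulmx_colsub mulmx1 mul_rowsub_mx mul1mx; apply/matrixP => k l; rewrite !mxE. Qed.

Lemma col_paE i : col_pa E U i = (sel i)^T *m (U *m delta_mx i 0).
Proof. by rewrite selT mul_rowsub_mx mul1mx -colE; apply/matrixP => k l; rewrite !mxE. Qed.

Lemma row_paE i : row_pa E U i i = (col_pa E U i)^T.
Proof. by apply/matrixP => k l; rewrite !mxE -[in LHS]U_posdef.1 mxE. Qed.

Lemma selK i : (sel i)^T *m sel i = 1%:M.
Proof.
rewrite selT mulmx_colsub mulmx1; apply/matrixP => k l; rewrite !mxE.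
by rewrite (inj_eq enum_val_inj).
Qed.

Lemma posdef_mx_pa i : posdefmx (mx_pa E U i).
Proof.
split; first by apply/matrixP => k l; rewrite !mxE -[in LHS]U_posdef.1 mxE.
move=> v v0; rewrite mx_paE.
have := U_posdef.2 (sel i *m v); rewrite trmx_mul !mulmxA; apply.
apply: contra_neq v0 => /(congr1 (mulmx (sel i)^T)).
by rewrite mulmxA selK mul1mx mulmx0.
Qed.

(** Completing the square in the quadratic form of the column e_i + l of L. *)
Lemma quad_form_column i (l : 'cV[R]_#|pa E i|) :
  quad_form U (delta_mx i 0 + sel i *m l) =
  schur_pa E U i + quad_form (mx_pa E U i) (l + m_ E U i).
Proof.
have Q_posdef := posdef_mx_pa i; have Qunit := posdefmx_unit Q_posdef.
rewrite !quad_formD//.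
have -> : quad_form U (delta_mx i 0) = U i i.
  by rewrite /quad_form trmx_delta -rowE -colE !mxE.
have -> : quad_form U (sel i *m l) = quad_form (mx_pa E U i) l.
  by rewrite /quad_form mx_paE trmx_mul !mulmxA.
have -> : (sel i *m l)^T *m (U *m delta_mx i 0) = l^T *m col_pa E U i.
  by rewrite col_paE trmx_mul !mulmxA.
have -> : (m_ E U i)^T *m (mx_pa E U i *m l) = (l^T *m col_pa E U i)^T.
  by rewrite /m_ !trmx_mul trmxK trmx_inv Q_posdef.1 mulmxA mulmxKV.
rewrite [_^T 0 0]mxE /schur_pa row_paE.
have -> : quad_form (mx_pa E U i) (m_ E U i) =
    ((col_pa E U i)^T *m invmx (mx_pa E U i) *m col_pa E U i) 0 0.
  by rewrite /quad_form /m_ trmx_mul trmx_inv Q_posdef.1 mulmxKV// mulmxA.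
ring.
Qed.

End column_factorization.

Section kernel_factorization.
Context {R : realType} {p : nat} (E : {set 'I_p * 'I_p}) (U : 'M[R]_p).
Context (alpha : 'I_p -> R).
Hypotheses (E_dag : dag E) (E_parent : parent_ordering E) (U_posdef : posdefmx U).
Implicit Types (t : #|E|.-tuple R).

Definition dag_col_kernel i : #|E|.-tuple R -> R :=
  col_kernel (loop_index E_dag i) (@parent_index p E E_dag i)
    (mx_pa E U i) (m_ E U i) (schur_pa E U i) (alpha i).

Lemma col_L_of_coord t i : col i (L_of_coord t) =
  delta_mx i 0 + colsub enum_val 1%:M *m
    (\col_(k < #|pa E i|) tnth t (parent_index E_dag k)).
Proof.
apply/matrixP => j u; rewrite ord1 !mxE.
rewrite (eq_bigr (fun k => (j == enum_val k)%:R * L_of_coord t (enum_val k) i)); last first.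
  by move=> k _; rewrite (L_of_coordE E_dag) !mxE.
rewrite -(big_enum_val (fun k => (j == k)%:R * L_of_coord t k i)).
have [->|ji] := eqVneq j i.
  rewrite big1 ?addr0// => k; rewrite inE => /andP[ki _].
  by rewrite eq_sym (negbTE ki) mul0r.
rewrite add0r; have [jpa|jpa] := boolP (j \in pa E i).
  rewrite (bigD1 j)//= eqxx mul1r big1 ?addr0 => [|k /andP[_ kj]].
    by rewrite mxE (negbTE ji).
  by rewrite eq_sym (negbTE kj) mul0r.
have [_ _ L0] := L_of_coord_cholesky E_parent t.
rewrite big1 => [|k kpa]; first by rewrite -(L0 _ _ ji jpa) mxE (negbTE ji).
by case: eqVneq => [jk|_]; rewrite ?mul0r//; rewrite jk kpa in jpa.
Qed.

Lemma trace_quad_form (D L : 'M[R]_p) : is_diag_mx D -> (forall i, 0 < D i i) ->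
  \tr (L *m invmx D *m L^T *m U) = \sum_i quad_form U (col i L) / D i i.
Proof.
move=> /is_diag_mxP Ddiag D0.
have Dinv : invmx D = diag_mx (\row_i (D i i)^-1).
  have DD : D *m diag_mx (\row_i (D i i)^-1) = 1%:M.
    apply/matrixP => i j; rewrite mul_mx_diag !mxE.
    case: eqVneq => [->|ij]; first by rewrite mulfV// gt_eqF.
    by rewrite Ddiag// mul0r.
  have [Du _] := mulmx1_unit DD.
  by rewrite -[RHS](mulKmx Du) DD mulmx1.
rewrite -!mulmxA mxtrace_mulC Dinv -mulmxA mul_diag_mx; apply: eq_bigr => i _.
rewrite mxE [X in X * _]mxE mulrC; congr (_ / _).
rewrite /quad_form tr_col -row_mul [LHS]mxE [RHS]mxE; apply: eq_bigr => k _.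
by congr (_ * _); rewrite [RHS]mxE.
Qed.

(** tr(L D^-1 L^T U) is the sum of the (L e_i)^T U (L e_i) / D_ii, to which
    [quad_form_column] applies. *)
Lemma dag_wishart_kernel_prod t : (forall i, 0 < tnth t (loop_index E_dag i)) ->
  dag_wishart_kernel U alpha (D_of_coord t) (L_of_coord t) =
  \prod_i dag_col_kernel i t.
Proof.
move=> x0.
have DE i : D_of_coord t i i = tnth t (loop_index E_dag i) by rewrite D_of_coordE.
rewrite /dag_wishart_kernel trace_quad_form; last 2 first.
- exact: D_of_coord_diag.
- by move=> i; rewrite DE.
rewrite mulr_sumr -sumrN expR_sum -big_split/=; apply: eq_bigr => i _.
rewrite /dag_col_kernel /col_kernel /col_diag x0 expRD DE; congr (_ * _).
  congr expR; rewrite col_L_of_coord quad_form_column// invfM mulrCA.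
  congr (- (_ * _)); congr (_ + quad_form _ _).
  by apply/colP => k; rewrite !mxE.
by rewrite /powR gt_eqF// mulNr.
Qed.

Lemma dag_col_kernel_prod0 t : ~ (forall i, 0 < tnth t (loop_index E_dag i)) ->
  \prod_i dag_col_kernel i t = 0.
Proof.
move=> /existsNP[i /negP x0]; apply/eqP/prodf_eq0; exists i => //.
by rewrite /dag_col_kernel /col_kernel /col_diag (negbTE x0).
Qed.

Lemma measurable_dag_col_kernel i : measurable_fun setT (dag_col_kernel i).
Proof. exact: measurable_col_kernel. Qed.

End kernel_factorization.

(** * Moments of one column under the joint density *)

Section column_moments.
Context {R : realType} {p : nat} (E : {set 'I_p * 'I_p}) (U : 'M[R]_p).
Context (alpha : 'I_p -> R) (c : R).
Hypotheses (E_dag : dag E) (E_parent : parent_ordering E) (U_posdef : posdefmx U).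
Hypothesis alpha_gt : forall i, #|pa E i|%:R + 4 < alpha i.
Implicit Types (t : #|E|.-tuple R) (H : #|E|.-tuple R -> R).

Let leb := @lebesgue_tuple R #|E|.
Local Notation intR := (integrable_fun leb).
Local Notation ck := (dag_col_kernel U alpha E_dag).

(** The density of the free parameters: it vanishes as soon as some D_ii is
    not positive, because the factor of that column does. *)
Definition dag_density t : R := c * \prod_i ck i t.

Local Notation g := dag_density.

Definition free_of_column i H := off_column (loop_index E_dag i) (@parent_index p E E_dag i) H.

Lemma loop_index_neq i l : l != i -> loop_index E_dag l != loop_index E_dag i.
Proof.
apply: contra_neq => /(congr1 enum_val); rewrite !enum_rankK_in ?E_dag.1//.
by case.
Qed.

Lemma loop_parent_index_neq i l (k : 'I_#|pa E i|) :
  l != i -> loop_index E_dag l != parent_index E_dag k.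
Proof.
apply: contra_neq => /(congr1 enum_val).
by rewrite !enum_rankK_in ?E_dag.1 ?pa_edge ?enum_valP// => -[_].
Qed.

Lemma parent_loop_index_neq i l (k : 'I_#|pa E l|) :
  l != i -> parent_index E_dag k != loop_index E_dag i.
Proof.
apply: contra_neq => /(congr1 enum_val).
by rewrite !enum_rankK_in ?E_dag.1 ?pa_edge ?enum_valP// => -[_].
Qed.

Lemma parent_index_col_neq i l (k : 'I_#|pa E l|) (k' : 'I_#|pa E i|) :
  l != i -> parent_index E_dag k != parent_index E_dag k'.
Proof.
apply: contra_neq => /(congr1 enum_val).
by rewrite !enum_rankK_in ?pa_edge ?enum_valP// => -[_].
Qed.

Lemma free_of_column_kernel i l : l != i -> free_of_column i (ck l).
Proof.
move=> li t t' tt'.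
have xE : tnth t (loop_index E_dag l) = tnth t' (loop_index E_dag l).
  by apply: tt' => [|k]; [exact: loop_index_neq|exact: loop_parent_index_neq].
have yE k : tnth t (@parent_index p E E_dag l k) = tnth t' (parent_index E_dag k).
  by apply: tt' => [|k']; [exact: parent_loop_index_neq|exact: parent_index_col_neq].
rewrite /dag_col_kernel /col_kernel /col_diag xE.
rewrite (_ : col_dev _ _ t = col_dev (@parent_index p E E_dag l) (m_ E U l) t')//.
by apply/colP => k; rewrite !mxE yE.
Qed.

(** The function of the other columns that multiplies the kernel of column i. *)
Let rest i H t := H t * (c * \prod_(l | l != i) ck l t).

Let rest_kernel i H F t : rest i H t * (ck i t * F t) = H t * F t * g t.
Proof. by rewrite /rest /dag_density [in RHS](bigD1 i)//=; ring. Qed.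

Let rest_free i H : free_of_column i H -> free_of_column i (rest i H).
Proof.
move=> Hfree t t' tt'; rewrite /rest (Hfree _ _ tt'); congr (_ * (_ * _)).
by apply: eq_bigr => l li; exact: (free_of_column_kernel li tt').
Qed.

Lemma measurable_dag_density : measurable_fun setT g.
Proof.
apply: measurable_funM => //; apply: measurable_prod => i _.
exact: measurable_dag_col_kernel.
Qed.

Let measurable_rest i H : measurable_fun setT H -> measurable_fun setT (rest i H).
Proof.
move=> mH; apply: measurable_funM => //; apply: measurable_funM => //.
under eq_fun do rewrite -big_filter.
by apply: measurable_prod => l _; exact: measurable_dag_col_kernel.
Qed.

Section one_column.
Variables (i : 'I_p) (H : #|E|.-tuple R -> R).
Hypotheses (mH : measurable_fun setT H) (Hfree : free_of_column i H).
Hypothesis intH : intR (fun t => H t * g t).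

Let Q_posdef : posdefmx (mx_pa E U i). Proof. exact: posdef_mx_pa. Qed.
Let b_inj : injective (@parent_index p E E_dag i). Proof. exact: parent_index_inj. Qed.
Let bNa (k : 'I_#|pa E i|) : parent_index E_dag k != loop_index E_dag i.
Proof. exact: parent_index_neq. Qed.

Let h := rest i H.
Let mh : measurable_fun setT h. Proof. exact: measurable_rest. Qed.
Let hfree : free_of_column i h. Proof. exact: rest_free. Qed.

Let hkE t : h t * ck i t = H t * g t.
Proof. by have := @rest_kernel i H (fun=> 1) t; rewrite !mulr1. Qed.

Let inthk : intR (fun t => h t * ck i t).
Proof. by rewrite (_ : (fun _ => _) = fun t => H t * g t)//; exact/funext. Qed.

Let kernelE (F : #|E|.-tuple R -> R) :
  (fun t => h t * (ck i t * F t)) = fun t => H t * F t * g t.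
Proof. by apply/funext => t; exact: rest_kernel. Qed.

Lemma integrable_diag_density : intR (fun t => H t * tnth t (loop_index E_dag i) * g t).
Proof.
rewrite -(kernelE (fun t => tnth t (loop_index E_dag i))).
exact: (integrable_col_diag b_inj bNa (alpha_gt i) mh hfree inthk).
Qed.

(** Conditionally on the other columns, E D_ii = r_i. *)
Lemma integral_diag_density :
  \int[leb]_t (H t * tnth t (loop_index E_dag i) * g t) =
  r_ E U alpha i * \int[leb]_t (H t * g t).
Proof.
have a0 : alpha i - #|pa E i|%:R - 4 != 0.
  by rewrite gt_eqF// -addrA -opprD subr_gt0.
have := integral_col_diag b_inj bNa (alpha_gt i) mh hfree inthk.
under eq_Rintegral do rewrite rest_kernel.
under [X in _ = _ * X]eq_Rintegral do rewrite hkE.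
by move=> eqI; rewrite /r_ mulrAC -eqI mulrAC mulfV// mul1r.
Qed.

Let y t : 'cV[R]_#|pa E i| := col_dev (@parent_index p E E_dag i) (m_ E U i) t.

Let yE t k : tnth t (parent_index E_dag k) = y t k 0 - m_ E U i k 0.
Proof. by rewrite /y mxE addrK. Qed.

Let inty k : intR (fun t => H t * y t k 0 * g t).
Proof.
rewrite -(kernelE (fun t => y t k 0)).
exact: (integrable_col b_inj bNa Q_posdef (alpha_gt i) k mh hfree inthk).
Qed.

Let int_y k : \int[leb]_t (H t * y t k 0 * g t) = 0.
Proof.
rewrite -(integral_col b_inj bNa Q_posdef (alpha_gt i) k mh hfree inthk).
by apply: eq_Rintegral => t _; rewrite -(rest_kernel i H (fun t => y t k 0)).
Qed.

Let intyy k l : intR (fun t => H t * (y t k 0 * y t l 0) * g t).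
Proof.
rewrite -(kernelE (fun t => y t k 0 * y t l 0)).
exact: (integrable_colM b_inj bNa Q_posdef (alpha_gt i) k l mh hfree inthk).
Qed.

Let int_yy k l : \int[leb]_t (H t * (y t k 0 * y t l 0) * g t) =
  invmx (mx_pa E U i) k l * (r_ E U alpha i * \int[leb]_t (H t * g t)).
Proof.
rewrite -integral_diag_density.
transitivity (invmx (mx_pa E U i) k l *
    \int[leb]_t (h t * (ck i t * tnth t (loop_index E_dag i)))).
  rewrite -(integral_colM b_inj bNa Q_posdef (alpha_gt i) k l mh hfree inthk).
  by apply: eq_Rintegral => t _; rewrite -(rest_kernel i H (fun t => y t k 0 * y t l 0)).
congr (_ * _); apply: eq_Rintegral => t _.
exact: (rest_kernel i H (fun t => tnth t (loop_index E_dag i))).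
Qed.

Lemma integrable_parent_density (k : 'I_#|pa E i|) :
  intR (fun t => H t * tnth t (parent_index E_dag k) * g t).
Proof.
rewrite (_ : (fun _ => _) = fun t => H t * y t k 0 * g t - m_ E U i k 0 * (H t * g t)).
  by apply: integrable_funB; [exact: inty|exact: integrable_funZ].
by apply/funext => t; rewrite yE; ring.
Qed.

(** Conditionally on the other columns, E L_ki = - m_i(k). *)
Lemma integral_parent_density (k : 'I_#|pa E i|) :
  \int[leb]_t (H t * tnth t (parent_index E_dag k) * g t) =
  - (m_ E U i k 0 * \int[leb]_t (H t * g t)).
Proof.
rewrite (@eq_Rintegral _ _ _ _ _ (fun t => H t * y t k 0 * g t - m_ E U i k 0 * (H t * g t))).
  rewrite (RintegralB measurableT (inty k)); last exact: integrable_funZ.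
  by rewrite int_y sub0r (RintegralZl _ measurableT intH).
by move=> t _; rewrite yE; ring.
Qed.

Let parentM (k l : 'I_#|pa E i|) t :
  H t * (tnth t (parent_index E_dag k) * tnth t (parent_index E_dag l)) * g t =
  (H t * (y t k 0 * y t l 0) * g t + m_ E U i k 0 * m_ E U i l 0 * (H t * g t)) -
  (m_ E U i l 0 * (H t * y t k 0 * g t) + m_ E U i k 0 * (H t * y t l 0 * g t)).
Proof. by rewrite !yE; ring. Qed.

Lemma integrable_parentM_density (k l : 'I_#|pa E i|) : intR (fun t =>
  H t * (tnth t (parent_index E_dag k) * tnth t (parent_index E_dag l)) * g t).
Proof.
under eq_fun do rewrite parentM.
apply: integrable_funB; apply: integrable_funD; try exact: integrable_funZ.
exact: intyy.
Qed.

(** Conditionally on the other columns, E (L_ki L_li) = r_i (Q^-1)_kl +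
    m_i(k) m_i(l), from l = y - m, the vanishing mean of y and its second moment
    r_i Q^-1. *)
Lemma integral_parentM_density (k l : 'I_#|pa E i|) : \int[leb]_t
    (H t * (tnth t (parent_index E_dag k) * tnth t (parent_index E_dag l)) * g t) =
  B_ E U alpha i k l * \int[leb]_t (H t * g t).
Proof.
under eq_Rintegral do rewrite parentM.
have intZ z (F : #|E|.-tuple R -> R) : intR F -> intR (fun t => z * F t).
  exact: integrable_funZ.
have intS := integrable_funD (intyy k l) (intZ (m_ E U i k 0 * m_ E U i l 0) _ intH).
have intT := integrable_funD (intZ (m_ E U i l 0) _ (inty k)) (intZ (m_ E U i k 0) _ (inty l)).
rewrite (RintegralB measurableT intS intT).
rewrite (RintegralD measurableT (intyy k l) (intZ _ _ intH)).
rewrite (RintegralD measurableT (intZ _ _ (inty k)) (intZ _ _ (inty l))).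
rewrite (RintegralZl _ measurableT intH) !(RintegralZl _ measurableT (inty _)).
rewrite !int_y !mulr0 addr0 subr0 int_yy /B_ !mxE.
rewrite big_ord_recl big_ord0 addr0 !mxE; ring.
Qed.

End one_column.
End column_moments.

(** * The mean recursion *)

Section sigma_of_coord.
Context {R : realType} {p : nat} (E : {set 'I_p * 'I_p}).
Hypotheses (E_dag : dag E) (E_parent : parent_ordering E).
Implicit Types (t : #|E|.-tuple R) (i j : 'I_p).

Definition sigma_of_coord t : 'M[R]_p :=
  (invmx (L_of_coord t))^T *m D_of_coord t *m invmx (L_of_coord t).

Lemma sigma_of_coord_sym t i j : sigma_of_coord t i j = sigma_of_coord t j i.
Proof. by apply: cholesky_sym; exact: D_of_coord_diag. Qed.

Let sum_parents t i j : \sum_(k in pa E i) sigma_of_coord t j k * L_of_coord t k i =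
  \sum_(k < #|pa E i|) sigma_of_coord t j (enum_val k) * tnth t (parent_index E_dag k).
Proof.
rewrite (big_enum_val (fun k => sigma_of_coord t j k * L_of_coord t k i)).
by apply: eq_bigr => k _; rewrite (L_of_coordE E_dag).
Qed.

Lemma sigma_of_coord_off t i j : (i < j)%N -> sigma_of_coord t j i =
  - \sum_(k < #|pa E i|) sigma_of_coord t j (enum_val k) * tnth t (parent_index E_dag k).
Proof.
move=> ij; rewrite -sum_parents {1}/sigma_of_coord.
rewrite (cholesky_recursion (D_of_coord_diag t) (L_of_coord_cholesky E_parent t) (ltnW ij)).
by rewrite -val_eqE/= ltn_eqF// mul0r sub0r.
Qed.

Lemma sigma_of_coord_diag t i : sigma_of_coord t i i = tnth t (loop_index E_dag i) +
  \sum_(k < #|pa E i|) \sum_(l < #|pa E i|) sigma_of_coord t (enum_val k) (enum_val l) *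
    (tnth t (parent_index E_dag k) * tnth t (parent_index E_dag l)).
Proof.
rewrite {1}/sigma_of_coord.
rewrite (cholesky_recursion (D_of_coord_diag t) (L_of_coord_cholesky E_parent t) (leqnn i)).
rewrite eqxx mul1r (D_of_coordE E_dag) sum_parents -sumrN; congr (_ + _).
apply: eq_bigr => k _; rewrite sigma_of_coord_sym.
rewrite sigma_of_coord_off; last exact: pa_gt (enum_valP k).
by rewrite mulNr opprK mulr_suml; apply: eq_bigr => l _; ring.
Qed.

Lemma measurable_sigma_of_coord i j : measurable_fun setT (fun t => sigma_of_coord t i j).
Proof.
move: i j; apply: (parent_ind E_parent) => [i j|i j ij IH|i IH].
- by under eq_fun do rewrite sigma_of_coord_sym.
- under eq_fun do rewrite (sigma_of_coord_off _ ij).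
  apply: measurable_funN; apply: measurable_sum => k; apply: measurable_funM.
    by apply: IH; exact: enum_valP.
  exact: measurable_tnth.
- under eq_fun do rewrite sigma_of_coord_diag.
  apply: measurable_funD; first exact: measurable_tnth.
  apply: measurable_sum => k; apply: measurable_sum => l; apply: measurable_funM.
    by apply: IH; exact: enum_valP.
  by apply: measurable_funM; exact: measurable_tnth.
Qed.

(** Sigma_ij only depends on the columns l >= min(i, j): the two recursion
    formulas for it refer to the column min(i, j) and to entries with a larger
    minimum. *)
Lemma sigma_of_coord_columns i j t t' :
  (forall l : 'I_p, (minn i j <= l)%N -> tnth t (loop_index E_dag l) = tnth t' (loop_index E_dag l) /\
    forall k : 'I_#|pa E l|, tnth t (parent_index E_dag k) = tnth t' (parent_index E_dag k)) ->
  sigma_of_coord t i j = sigma_of_coord t' i j.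
Proof.
move: i j; apply: (parent_ind E_parent) => [i j IH|i j ij IH|i IH] tt'.
- by rewrite sigma_of_coord_sym IH 1?sigma_of_coord_sym// => l; rewrite minnC; exact: tt'.
- rewrite !sigma_of_coord_off//; congr (- _); apply: eq_bigr => k _.
  rewrite IH ?enum_valP// => [|l kl].
    by have [|_ ->//] := tt' i; rewrite geq_minr.
  apply: tt'; have := pa_gt E_parent (enum_valP k); lia.
- rewrite !sigma_of_coord_diag; have [|-> tt'i] := tt' i; first by rewrite minnn.
  congr (_ + _); apply: eq_bigr => k _; apply: eq_bigr => l _; rewrite !tt'i.
  rewrite IH ?enum_valP// => l' kl; apply: tt'.
  have := pa_gt E_parent (enum_valP k); have := pa_gt E_parent (enum_valP l); lia.
Qed.

Lemma free_of_column_sigma (i j k : 'I_p) : (i < j)%N -> (i < k)%N ->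
  free_of_column E_dag i (fun t => sigma_of_coord t j k).
Proof.
move=> ij ik t t' tt'; apply: sigma_of_coord_columns => l jkl.
have li : l != i by apply/eqP => li; rewrite li in jkl; lia.
split=> [|u]; apply: tt' => [|v].
- exact: loop_index_neq.
- exact: loop_parent_index_neq.
- exact: parent_loop_index_neq.
- exact: parent_index_col_neq.
Qed.

End sigma_of_coord.

Section sigma_moments.
Context {R : realType} {p : nat} (E : {set 'I_p * 'I_p}) (U : 'M[R]_p).
Context (alpha : 'I_p -> R) (c : R).
Hypotheses (E_dag : dag E) (E_parent : parent_ordering E) (U_posdef : posdefmx U).
Hypothesis alpha_gt : forall i, #|pa E i|%:R + 4 < alpha i.
Implicit Types (t : #|E|.-tuple R) (i j : 'I_p).

Let leb := @lebesgue_tuple R #|E|.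
Local Notation intR := (integrable_fun leb).
Local Notation g := (dag_density U alpha c E_dag).
Local Notation S := (@sigma_of_coord R p E).
Hypothesis intg : intR g.
Hypothesis integral_g : \int[leb]_t g t = 1.

Lemma integrable_sigma_density i j : intR (fun t => S t i j * g t).
Proof.
move: i j; apply: (parent_ind E_parent) => [i j|i j ij IH|i IH].
- by under eq_fun do rewrite sigma_of_coord_sym.
- rewrite (_ : (fun _ => _) = fun t => \sum_(k < #|pa E i|)
    - 1 * (S t j (enum_val k) * tnth t (parent_index E_dag k) * g t)).
    apply: integrable_fun_sum => k; apply: integrable_funZ.
    apply: integrable_parent_density => //.
    + exact: measurable_sigma_of_coord.
    + by apply: free_of_column_sigma => //; exact: pa_gt (enum_valP k).
    + by apply: IH; exact: enum_valP.
  apply/funext => t; rewrite (sigma_of_coord_off E_dag)// mulNr mulr_suml -sumrN.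
  by apply: eq_bigr => k _; ring.
- rewrite (_ : (fun _ => _) = fun t => 1 * tnth t (loop_index E_dag i) * g t +
    \sum_(k < #|pa E i|) \sum_(l < #|pa E i|) (S t (enum_val k) (enum_val l) *
    (tnth t (parent_index E_dag k) * tnth t (parent_index E_dag l)) * g t)).
    apply: integrable_funD.
      apply: integrable_diag_density => //.
      by under eq_fun do rewrite mul1r.
    apply: integrable_fun_sum => k; apply: integrable_fun_sum => l.
    apply: integrable_parentM_density => //.
    + exact: measurable_sigma_of_coord.
    + by apply: free_of_column_sigma => //; apply: pa_gt (enum_valP _).
    + by apply: IH; exact: enum_valP.
  apply/funext => t; rewrite (sigma_of_coord_diag E_dag)// mul1r mulrDl; congr (_ + _).
  by rewrite mulr_suml; apply: eq_bigr => k _; rewrite mulr_suml.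
Qed.

Let M : 'M[R]_p := \matrix_(i, j) \int[leb]_t (S t i j * g t).

Lemma mean_sigma_recursion : mean_recursion E U alpha M.
Proof.
have Msym i j : M i j = M j i.
  by rewrite !mxE; apply: eq_Rintegral => t _; rewrite sigma_of_coord_sym.
move=> i; split=> [j ij|].
  rewrite (Msym i j); split=> //; rewrite [LHS]mxE [RHS]mxE.
  have intSl (k : 'I_#|pa E i|) : intR (fun t =>
      S t j (enum_val k) * tnth t (parent_index E_dag k) * g t).
    apply: integrable_parent_density => //.
    + exact: measurable_sigma_of_coord.
    + by apply: free_of_column_sigma => //; exact: pa_gt (enum_valP k).
    + exact: integrable_sigma_density.
  rewrite (@eq_Rintegral _ _ _ _ _ (fun t => \sum_(k < #|pa E i|)
      - 1 * (S t j (enum_val k) * tnth t (parent_index E_dag k) * g t))); last first.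
    move=> t _; rewrite (sigma_of_coord_off E_dag)// mulNr mulr_suml -sumrN.
    by apply: eq_bigr => k _; ring.
  rewrite Rintegral_sum => [|k]; last exact: integrable_funZ.
  apply: eq_bigr => k _; rewrite (RintegralZl _ measurableT (intSl k)).
  rewrite integral_parent_density//.
  + by rewrite mulN1r opprK mulrC !mxE.
  + exact: measurable_sigma_of_coord.
  + by apply: free_of_column_sigma => //; exact: pa_gt (enum_valP k).
  + exact: integrable_sigma_density.
have int1 : intR (fun t => 1 * g t) by under eq_fun do rewrite mul1r.
have intx : intR (fun t => 1 * tnth t (loop_index E_dag i) * g t).
  exact: integrable_diag_density.
have intSll (k l : 'I_#|pa E i|) : intR (fun t => S t (enum_val k) (enum_val l) *
    (tnth t (parent_index E_dag k) * tnth t (parent_index E_dag l)) * g t).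
  apply: integrable_parentM_density => //.
  + exact: measurable_sigma_of_coord.
  + by apply: free_of_column_sigma => //; exact: pa_gt (enum_valP _).
  + exact: integrable_sigma_density.
rewrite [LHS]mxE (@eq_Rintegral _ _ _ _ _ (fun t => 1 * tnth t (loop_index E_dag i) * g t +
    \sum_(k < #|pa E i|) \sum_(l < #|pa E i|) (S t (enum_val k) (enum_val l) *
    (tnth t (parent_index E_dag k) * tnth t (parent_index E_dag l)) * g t))); last first.
  move=> t _; rewrite (sigma_of_coord_diag E_dag)// mul1r mulrDl; congr (_ + _).
  by rewrite mulr_suml; apply: eq_bigr => k _; rewrite mulr_suml.
rewrite RintegralD//; last first.
  by apply: integrable_fun_sum => k; apply: integrable_fun_sum => l; exact: intSll.
rewrite integral_diag_density//.
rewrite (@eq_Rintegral _ _ _ _ _ g) => [|t _]; last by rewrite mul1r.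
rewrite integral_g mulr1; congr (_ + _).
rewrite Rintegral_sum => [|k]; last by apply: integrable_fun_sum => l; exact: intSll.
rewrite /mxtrace.
under eq_bigr => k _.
  rewrite Rintegral_sum; last by move=> l; exact: intSll.
  over.
rewrite exchange_big/=; apply: eq_bigr => l _; rewrite [RHS]mxE; apply: eq_bigr => k _.
rewrite integral_parentM_density//.
+ by rewrite mulrC; congr (_ * _); rewrite [RHS]mxE Msym mxE.
+ exact: measurable_sigma_of_coord.
+ by apply: free_of_column_sigma => //; exact: pa_gt (enum_valP _).
+ exact: integrable_sigma_density.
Qed.

End sigma_moments.

(** The recursion expresses every entry by entries treated before it, in the
    order of [parent_ind]. *)
Lemma mean_recursion_unique (R : realType) (p : nat) (E : {set 'I_p * 'I_p})
    (U : 'M[R]_p) (alpha : 'I_p -> R) (M N : 'M[R]_p) : parent_ordering E ->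
  mean_recursion E U alpha M -> mean_recursion E U alpha N -> N = M.
Proof.
move=> E_parent recM recN; apply/matrixP; apply: (parent_ind E_parent) => [i j NM|i j ij IH|i IH].
- case: (ltngtP i j) => [ij|ji|/val_inj ij].
  + by have [-> _] := (recN i).1 j ij; have [-> _] := (recM i).1 j ij.
  + by have [<- _] := (recN j).1 i ji; have [<- _] := (recM j).1 i ji.
  + by rewrite -ij in NM *.
- have [NS NE] := (recN i).1 j ij; have [MS ME] := (recM i).1 j ij.
  rewrite NS NE MS ME; congr ((_ *m _) 0 0).
  by apply/rowP => k; rewrite !mxE; apply: IH; exact: enum_valP.
- rewrite (recN i).2 (recM i).2; congr (_ + \tr (_ *m _)).
  by apply/matrixP => k l; rewrite !mxE; apply: IH; exact: enum_valP.
Qed.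

(** * The DAG-Wishart law *)

Section wishart_density.
Context {R : realType} {p : nat} (E : {set 'I_p * 'I_p}) (U : 'M[R]_p).
Context (alpha : 'I_p -> R).
Hypotheses (E_dag : dag E) (E_parent : parent_ordering E) (U_posdef : posdefmx U).

Lemma dag_density_ge0 (c : R) t : 0 <= c -> 0 <= dag_density U alpha c E_dag t.
Proof.
by move=> c0; rewrite mulr_ge0// prodr_ge0// => i _; exact: col_kernel_ge0.
Qed.

Lemma dag_wishart_massE A : measurable A -> dag_wishart_mass U alpha A =
  (\int[lebesgue_tuple #|E|]_(t in A) (dag_density U alpha 1 E_dag t)%:E)%E.
Proof.
move=> mA; rewrite /dag_wishart_mass integral_mkcondr; apply: eq_integral => t _.
rewrite patchE /dag_density mul1r; case: ifPn.
  rewrite inE /= => /(Theta_of_coord E_dag E_parent) x0.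
  by rewrite (dag_wishart_kernel_prod _ E_parent U_posdef x0).
rewrite notin_setE /= => Nx0; rewrite dag_col_kernel_prod0// => x0.
by apply: Nx0; exact/(Theta_of_coord E_dag E_parent).
Qed.

(** The normalizing factor is nonnegative because the total mass of the law
    is 1 and that of the kernel is nonnegative. *)
Lemma dag_wishart_density d (T : measurableType d) (P : probability T R)
    (D L : T -> 'M[R]_p) : dag_wishart E U alpha P D L ->
  exists2 c : R, 0 <= c & forall A, measurable A ->
    P ((fun w => Theta_coord E (D w) (L w)) @^-1` A) =
    (\int[lebesgue_tuple #|E|]_(t in A) (dag_density U alpha c E_dag t)%:E)%E.
Proof.
move=> [_ _ [c Pc]].
have mass_ge0 A : (0 <= dag_wishart_mass U alpha A :> \bar R)%E.
  by apply: integral_ge0 => t _; rewrite lee_fin mulr_ge0 ?expR_ge0// prodr_ge0// => i _;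
    exact: powR_ge0.
have c0 : 0 <= c.
  rewrite leNgt; apply/negP => c0.
  have := Pc setT measurableT; rewrite preimage_setT probability_setT => cmass.
  have : (1 <= 0 :> \bar R)%E by rewrite cmass mule_le0_ge0// lee_fin ltW.
  by rewrite lee_fin ler10.
exists c => // A mA; rewrite Pc// dag_wishart_massE// -ge0_integralZl//.
- by apply: eq_integral => t _; rewrite -EFinM /dag_density mul1r.
- apply/measurable_funTS/measurable_EFinP; exact: measurable_dag_density.
- by move=> t _; rewrite lee_fin dag_density_ge0.
Qed.

End wishart_density.

Theorem proposition5p10 (R : realType) (p : nat) (E : {set 'I_p * 'I_p})
    (U : 'M[R]_p) (alpha : 'I_p -> R)
    (d : measure_display) (T : measurableType d) (P : probability T R)
    (D L Sigma : T -> 'M[R]_p) (M : 'M[R]_p) :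
  dag E ->
  parent_ordering E ->
  posdefmx U ->
  dag_wishart E U alpha P D L ->
  (forall i, #|pa E i|%:R + 4 < alpha i) ->
  (forall w, Sigma w = (invmx (L w))^T *m D w *m invmx (L w)) ->
  M = mean_mx P Sigma ->
  [/\ forall i j, P.-integrable setT (fun w => (Sigma w i j)%:E),
      M^T = M,
      mean_recursion E U alpha M,
      forall N, mean_recursion E U alpha N -> N = M &
      mean_ffun P (fun w => incomplete E (Sigma w)) = incomplete E M].
Proof.
move=> E_dag E_parent U_posdef wishart alpha_gt SigmaE ->.
have [DL_Theta mtheta _] := wishart.
have [c c0 densityE] := dag_wishart_density E_dag E_parent U_posdef wishart.
set theta := fun w => Theta_coord E (D w) (L w) in mtheta densityE.
pose leb := @lebesgue_tuple R #|E|; pose g := dag_density U alpha c E_dag.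
have mg : measurable_fun setT g by exact: measurable_dag_density.
have g0 t : 0 <= g t by exact: dag_density_ge0.
have int1 : (\int[leb]_t (g t)%:E = 1)%E.
  by rewrite -densityE// preimage_setT probability_setT.
have intg : integrable_fun leb g.
  apply: integrable_funP => //.
  by under eq_integral do rewrite ger0_norm//; rewrite int1 ltry.
have SigmaE' w i j : Sigma w i j = sigma_of_coord (theta w) i j.
  have [DE LE] := Theta_coordK E_dag E_parent (DL_Theta w).
  by rewrite SigmaE /sigma_of_coord DE LE.
have transfer i j := integral_random_density mtheta mg g0 densityE
  (measurable_sigma_of_coord E_dag E_parent i j)
  (integrable_sigma_density E_parent U_posdef alpha_gt intg i j).
have int_Sigma i j : P.-integrable setT (fun w => (Sigma w i j)%:E).
  by under eq_fun do rewrite SigmaE'; exact: (transfer i j).1.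
have meanE : mean_mx P Sigma =
    \matrix_(i, j) \int[leb]_t (sigma_of_coord t i j * g t).
  apply/matrixP => i j; rewrite !mxE unlock /Rintegral -(transfer i j).2.
  by congr fine; apply: eq_integral => w _; rewrite SigmaE'.
have recM : mean_recursion E U alpha (mean_mx P Sigma).
  rewrite meanE; apply: mean_sigma_recursion => //.
  by rewrite /Rintegral int1.
split=> //.
- apply/matrixP => i j; rewrite !mxE; congr fine; congr expectation.
  by apply/funext => w; rewrite !SigmaE' sigma_of_coord_sym.
- by move=> N; exact: mean_recursion_unique.
- apply/ffunP => e; rewrite !ffunE mxE; congr fine; congr expectation.
  by apply/funext => w; rewrite ffunE.
Qed.
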